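(* Let $F:\Omega\to\mathcal M$ be a target function with values in a Riemannian manifold $\mathcal M$ of dimension $q$, let $\widetilde F_n$ be the manifold-valued multiscale estimator with a fixed number $n$ of levels built from noisy samples, and suppose Assumptions (A1) local geometry, (A2) local consistency and (A3) coordinate noise stated in the context hold, together with $\sup_{x\in\Omega}\|A_n(x)\|_{\mathrm{op}}\le C$, and that the intrinsic mean $\overline F_n(x)=\mathbb{E}_{\mathcal M}[\widetilde F_n(x)]$ exists uniquely in the same neighborhood of $p$, all uniformly for $x\in\Omega$ in the fixed chart. Let $\mu$ be a finite measure on $\Omega$, and set $\chi=r^3+\sigma^2$, $e_n(x)=u(x)-A_n(x)u_X$, $$\mathcal B_n^2=\int_\Omega\|e_n(x)\|^2\,d\mu(x),\qquad \mathcal V_n=\int_\Omega\operatorname{tr}\bigl(A_n(x)\Sigma A_n(x)^*\bigr)\,d\mu(x).$$ Then $$\operatorname{IVar}_n=\mathcal V_n+O(r^2\sigma^2+r^3\sigma+r^6),$$ $$\operatorname{MISE}_n=\mathcal B_n^2+\mathcal V_n+O\bigl(r^2\mathcal B_n^2+\chi\mathcal B_n+r^2\sigma^2+\chi\sigma+\chi^2\bigr).$$ If, additionally, $\Sigma=\sigma^2I_{Nq}+O(r\sigma^2)$ in operator norm, then $$\mathcal V_n=\sigma^2\int_\Omega\operatorname{tr}\bigl(A_n(x)A_n(x)^*\bigr)\,d\mu(x)+O(r\sigma^2).$$ In particular, if $A_n(x)=a_n(x)\otimes I_q$ for a scalar row operator $a_n(x)$ (a row vector in $\mathbb{R}^N$),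 the leading isotropic term $\sigma^2\int_\Omega\operatorname{tr}(A_n(x)A_n(x)^* )\,d\mu(x)$ equals $q\sigma^2\int_\Omega\|a_n(x)\|_2^2\,d\mu(x)$, where $\sigma^2$ is the variance per tangent coordinate.
   Context: Setting. $\mathcal M$ is a Riemannian manifold of dimension $q$ with geodesic distance $\rho$; $\exp_p,\log_p$ are the Riemannian exponential and logarithm; $\Omega\subseteq\mathbb{R}^d$ is the evaluation domain and $F$ is also defined at the data sites. The data sites $x_1,\dots,x_N\in\mathbb{R}^d$ and a nested hierarchy $X_1\subset\cdots\subset X_n=X=\{x_i\}$ are fixed. A normal coordinate chart centered at $p\in\mathcal M$ is fixed; $u(x)=\log_pF(x)$, $u_X=(u(x_i))_{i=1}^N\in(T_p\mathcal M)^N$. The noisy manifold samples are $F_i^\varepsilon\in\mathcal M$, and $u_X^\varepsilon=(\log_pF_i^\varepsilon)_{i=1}^N$. Euclidean multiscale scheme: with linear level operators $Q_i$, $M_0=0$, $E_0=I$, $M_i=M_{i-1}+Q_iE_{i-1}$, $E_i=E_{i-1}-Q_iE_{i-1}$. The manifold scheme producing $\widetilde F_n$ is the analogous recursion with subtraction and addition replaced by Riemannian logarithm and exponential maps and averages replaced by intrinsic averages. $A_n(x):(T_p\mathcal M)^N\to T_p\mathcal M$ denotes the deterministic linear map obtained by performing the corresponding Euclidean multiscale scheme on tangent vectors and evaluating at $x$. The link between $\widetilde F_n$ and $A_n$ is the one in (A2). Constants. $C$ is a generic constant (possibly different at each occurrence) which may depend on the fixed number of levels, the data size, and uniform stability and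 geometric bounds, but not on $r$ or $\sigma$. $O(\cdot)$ denotes a quantity bounded in norm by such a constant times the argument; in the integrated estimates the constant may also depend on $\mu(\Omega)$. (A1) Local geometry: the target values, the noisy data, all intermediate manifold values and the outputs of the scheme lie in a strongly convex normal neighborhood of $p$ of radius $Cr$, on which the sectional curvature and the first two derivatives of the chart are uniformly bounded; moreover $r,\sigma\le1$ are sufficiently small. (A2) Local consistency: almost surely and uniformly in $x$, $w(x):=\log_p\widetilde F_n(x)=A_n(x)u_X^\varepsilon+g_n(x)$ with $\|g_n(x)\|\le Cr^3$. (A3) Coordinate noise: $\|u_X^\varepsilon-u_X\|\le Cr$ almost surely; $\mathbb{E}u_X^\varepsilon=u_X+\beta$ with $\|\beta\|\le C\sigma^2$; and with $\zeta=u_X^\varepsilon-\mathbb{E}u_X^\varepsilon$ and $\Sigma=\mathbb{E}[\zeta\zeta^*]$, $\operatorname{tr}\Sigma\le C\sigma^2$. The intrinsic (Karcher) mean $\mathbb{E}_{\mathcal M}[Z]$ of an $\mathcal M$-valued random variable $Z$ is the minimizer of $y\mapsto\mathbb{E}[\rho(y,Z)^2]$. Pointwise variance and mean squared error: $\operatorname{Var}[\widetilde F_n](x)=\mathbb{E}\bigl[\rho(\mathbb{E}_{\mathcal M}[\widetilde F_n(x)],\widetilde F_n(x))^2\bigr]$, $\operatorname{MSE}[\widetilde F_n,F](x)=\mathbb{E}\bigl[\rho(F(x),\widetilde F_n(x))^2\bigr]$. Integrated versions: $\operatorname{IVar}_n=\int_\Omega\operatorname{Var}[\widetilde F_n](x)\,d\mu(x)$,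 $\operatorname{MISE}_n=\int_\Omega\operatorname{MSE}[\widetilde F_n,F](x)\,d\mu(x)$. $\mathcal B_n\ge0$ is the square root of $\mathcal B_n^2$. Norms on $T_p\mathcal M$ and $(T_p\mathcal M)^N$ are those induced by the Riemannian metric at $p$. *)

(* Defs.v *)
From HB Require Import structures.
From mathcomp Require Import all_boot all_order all_algebra.
From mathcomp Require Import all_classical all_reals all_analysis.
From mathcomp Require Import measurable_realfun.

Set Implicit Arguments.
Unset Strict Implicit.
Unset Printing Implicit Defensive.

Import Order.TTheory GRing.Theory Num.Theory.
Import numFieldNormedType.Exports.

Local Open Scope classical_set_scope.
Local Open Scope ring_scope.

(* The library norm on matrices is the sup norm; [enorm] is the Euclidean
   (Frobenius) norm, used for R^q and, on N x q matrices, for (R^q)^N. *)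
Definition edot (R : realType) (m k : nat) (v w : 'M[R]_(m, k)) : R :=
  \sum_i \sum_j v i j * w i j.

Definition enorm (R : realType) (m k : nat) (v : 'M[R]_(m, k)) : R :=
  Num.sqrt (edot v v).

Section Coordinates.
Context (R : realType) (q : nat).
Local Notation V := 'rV[R]_q.

Definition pderiv (W : normedModType R) (i : 'I_q) (f : V -> W) : V -> W :=
  fun y => 'D_(delta_mx 0 i : V) f y.

(* C^infinity on the open set U: all iterated partial derivatives are
   (Frechet) differentiable at the points of U. *)
Definition smooth_on (W : normedModType R) (U : set V) (f : V -> W) : Prop :=
  forall (s : seq 'I_q) (y : V), U y -> differentiable (foldr (@pderiv W) f s) y.

Section Gram.
Variable G : V -> 'M[R]_q.

Definition gdot (y v w : V) : R := (v *m G y *m w^T) 0 0.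

Definition gnorm (y v : V) : R := Num.sqrt (gdot y v v).

(* Gamma^k_ij = 1/2 g^{kl} (d_i g_jl + d_j g_il - d_l g_ij) *)
Definition christoffel (k i j : 'I_q) (y : V) : R :=
  2^-1 * \sum_l invmx (G y) k l *
    (pderiv i (fun z => G z j l) y + pderiv j (fun z => G z i l) y
     - pderiv l (fun z => G z i j) y).

Definition Gamma (y v w : V) : V :=
  \row_k \sum_i \sum_j christoffel k i j y * v 0 i * w 0 j.

(* R(d_i, d_j) d_k = R^l_kij d_l, with
   R(X,Y)Z = nabla_X nabla_Y Z - nabla_Y nabla_X Z - nabla_[X,Y] Z *)
Definition riemann_tensor (l k i j : 'I_q) (y : V) : R :=
  pderiv i (christoffel l j k) y - pderiv j (christoffel l i k) y
  + \sum_m (christoffel l i m y * christoffel m j k y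
            - christoffel l j m y * christoffel m i k y).

Definition riemann (y v w z : V) : V :=
  \row_l \sum_i \sum_j \sum_k riemann_tensor l k i j y * v 0 i * w 0 j * z 0 k.

(* Sectional curvature of span(v, w); it is 0 (as _ / 0 = 0) if v and w are
   linearly dependent, so a bound on |sect| constrains genuine planes only. *)
Definition sect (y v w : V) : R :=
  gdot y (riemann y v w w) v /
  (gdot y v v * gdot y w w - gdot y v w ^+ 2).

End Gram.
End Coordinates.

(* Values of [cmap] outside [cdom] and of [cinv] outside [ccod] are junk. *)
Record chart (R : realType) (q : nat) (M : topologicalType) := Chart {
  cdom : set M;
  ccod : set 'rV[R]_q;
  cmap : M -> 'rV[R]_q;
  cinv : 'rV[R]_q -> M }.

Section Charts.
Context (R : realType) (q : nat) (M : topologicalType).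
Local Notation V := 'rV[R]_q.
Implicit Types c : chart R q M.

Definition homeo_chart c : Prop :=
  [/\ open (cdom c) /\ open (ccod c),
      forall x, cdom c x -> ccod c (cmap c x) /\ cinv c (cmap c x) = x,
      forall y, ccod c y -> cdom c (cinv c y) /\ cmap c (cinv c y) = y,
      {within cdom c, continuous (cmap c)} &
      {within ccod c, continuous (cinv c)}].

Definition transition c c' : V -> V := fun y => cmap c' (cinv c y).

Definition overlap c c' : set V := [set y | ccod c y /\ cdom c' (cinv c y)].

Definition smooth_compatible c c' : Prop :=
  smooth_on (overlap c c') (transition c c') /\
  smooth_on (overlap c' c) (transition c' c).

End Charts.

Record riemannian_manifold (R : realType) (q : nat) := RiemannianManifold {
  space :> topologicalType;
  atlas : set (chart R q space);
  chart_at : space -> chart R q space;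
  metric : chart R q space -> 'rV[R]_q -> 'M[R]_q;
  space_hausdorff : hausdorff_space space;
  space_second_countable : @second_countable space;
  atlas_homeo : forall c, atlas c -> homeo_chart c;
  atlas_cover : forall x, atlas (chart_at x) /\ cdom (chart_at x) x;
  atlas_smooth : forall c c', atlas c -> atlas c' -> smooth_compatible c c';
  atlas_maximal : forall c, homeo_chart c ->
    (forall c', atlas c' -> smooth_compatible c c') -> atlas c;
  metric_smooth : forall c, atlas c -> forall i j,
    smooth_on (ccod c) (fun y => metric c y i j : R);
  metric_sym : forall c, atlas c -> forall y, ccod c y ->
    (metric c y)^T = metric c y;
  metric_pos : forall c, atlas c -> forall y, ccod c y ->
    forall v : 'rV[R]_q, v != 0 -> 0 < gdot (metric c) y v v;
  (* vectors are rows, so the differential of f at y is v |-> v *m 'J f y *)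
  metric_tensor : forall c c', atlas c -> atlas c' ->
    forall y, overlap c c' y ->
      metric c y = 'J (transition c c') y *m
                   metric c' (transition c c' y) *m
                   ('J (transition c c') y)^T }.

Section Geometry.
Context (R : realType) (q : nat) (M : riemannian_manifold R q).
Local Notation V := 'rV[R]_q.
Implicit Types (c : chart R q M) (gam : R -> M) (x y p : M).

Definition in_chart c gam : R -> V := fun t => cmap c (gam t).

(* Curves are total functions on R of which only the germ along [0, 1]
   matters; C^1 curves and geodesics on [0, 1] always extend a bit beyond. *)
Definition C1_at gam (t : R) : Prop :=
  {for t, continuous gam} /\
  forall c, atlas c -> cdom c (gam t) ->
    (\forall s \near t, derivable (in_chart c gam) s 1) /\
    {for t, continuous (derive1 (in_chart c gam))}.

Definition C1_curve gam : Prop := forall t, 0 <= t <= 1 -> C1_at gam t.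

Definition speed gam (t : R) : R :=
  let c := chart_at (gam t) in
  gnorm (metric c) (cmap c (gam t)) (derive1 (in_chart c gam) t).

Definition curve_length gam : \bar R :=
  (\int[@lebesgue_measure R]_(t in `[0%R, 1%R]) (speed gam t)%:E)%E.

(* Infimum of lengths of C^1 (not necessarily regular) curves, which agrees
   with the one over piecewise C^1 curves; +oo between components. *)
Definition rho x y : \bar R :=
  ereal_inf [set curve_length gam | gam in
    [set gam | [/\ C1_curve gam, gam 0 = x & gam 1 = y]]].

Definition geodesic_at gam (t : R) : Prop :=
  {for t, continuous gam} /\
  forall c, atlas c -> cdom c (gam t) ->
    let u := in_chart c gam in
    [/\ \forall s \near t, derivable u s 1,
        derivable (derive1 u) t 1 &
        derive1 (derive1 u) t
          = - Gamma (metric c) (u t) (derive1 u t) (derive1 u t)].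

Definition geodesic gam : Prop := forall t, 0 <= t <= 1 -> geodesic_at gam t.

(* Tangent vectors at p are represented by their components in a chart c
   around p.  [is_exp c p v y] says that exp_p v is defined and equals y. *)
Definition geodesic_from c p (v : V) gam : Prop :=
  [/\ geodesic gam, gam 0 = p & derive1 (in_chart c gam) 0 = v].

Definition is_exp c p (v : V) y : Prop :=
  (exists gam, geodesic_from c p v gam) /\
  (forall gam, geodesic_from c p v gam -> gam 1 = y).

Definition minimizing_geodesic x y gam : Prop :=
  [/\ geodesic gam, gam 0 = x, gam 1 = y & curve_length gam = rho x y].

(* c is a normal chart centered at p on the ball of radius rad: its coordinate
   basis at p is orthonormal, identifying T_pM isometrically with R^q, and the
   inverse chart is exp_p; thus [cmap c] is log_p on [coord_ball c rad]. *)
Definition normal_chart c p (rad : R) : Prop :=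
  [/\ atlas c /\ cdom c p, cmap c p = 0, metric c 0 = 1%:M,
      forall v : V, enorm v < rad -> ccod c v &
      forall v : V, enorm v < rad -> is_exp c p v (cinv c v)].

Definition coord_ball c (rad : R) : set M :=
  [set x | cdom c x /\ enorm (cmap c x) < rad].

Definition strongly_convex (B : set M) : Prop :=
  forall x y, B x -> B y ->
    exists2 gam, minimizing_geodesic x y gam /\
                 (forall t, 0 <= t <= 1 -> B (gam t))
      & forall gam', minimizing_geodesic x y gam' ->
          forall t, 0 <= t <= 1 -> gam' t = gam t.

Definition sectional_curvature_bounded c (rad C : R) : Prop :=
  forall y v w : V, enorm y < rad -> `|sect (metric c) y v w| <= C.

(* First derivative of the chart: d(cmap c) is the identity in coordinates.
   Second derivative: the covariant Hessian of the chart, whose value at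
   (v, v) is - Gamma(v, v).  Both are measured from the Riemannian norm on TM
   to the Euclidean norm on R^q; the Hessian is symmetric, so its diagonal
   values determine it. *)
Definition chart_derivatives_bounded c (rad C : R) : Prop :=
  forall y v : V, enorm y < rad ->
    enorm v <= C * gnorm (metric c) y v /\
    enorm (Gamma (metric c) y v v) <= C * gnorm (metric c) y v ^+ 2.

End Geometry.

Definition borelRd (R : realType) (d : nat) :=
  g_sigma_algebraType (@open 'rV[R]_d).

Section EuclideanScheme.
Context (R : realType) (d q N : nat) (site : 'I_N -> borelRd R d).

(* [Q i x : (R^q)^N -> R^q] is the level-i operator acting on values at the
   data sites (row j is the value at site j) and evaluated at x. *)
Variable Q : nat -> borelRd R d -> {linear 'M[R]_(N, q) -> 'rV[R]_q}.

Definition level_supported (X : nat -> {set 'I_N}) (n : nat) : Prop :=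
  forall i x, (0 < i <= n)%N -> forall v w : 'M[R]_(N, q),
    (forall j, j \in X i -> row j v = row j w) -> Q i x v = Q i x w.

(* E_i = E_{i-1} - Q_i E_{i-1}, restricted to the data sites *)
Fixpoint residual (i : nat) (v : 'M[R]_(N, q)) : 'M[R]_(N, q) :=
  if i is i'.+1 then
    let e := residual i' v in e - \matrix_(j < N) Q i'.+1 (site j) e
  else v.

(* M_i = M_{i-1} + Q_i E_{i-1}, evaluated at x; A_n = multiscale n *)
Fixpoint multiscale (i : nat) (x : borelRd R d) (v : 'M[R]_(N, q)) : 'rV[R]_q :=
  if i is i'.+1 then multiscale i' x v + Q i'.+1 x (residual i' v) else 0.

End EuclideanScheme.

(* Matrix of a linear map (R^q)^N -> R^q acting on row-vectorized data by
   v |-> v *m A.  In this row convention A Sigma A^* is A^T *m Sigma *m A. *)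
Definition opmx (R : realType) (N q : nat) (f : 'M[R]_(N, q) -> 'rV[R]_q) :
  'M[R]_(N * q, q) := lin1_mx (fun v => f (vec_mx v)).

Section Probability.
Context (R : realType) (dP : measure_display) (T : measurableType dP)
  (P : probability T R).

Definition random_element (M : topologicalType) (Z : T -> M) : Prop :=
  forall U : set M, open U -> measurable (Z @^-1` U).

Definition expectmx (m k : nat) (Y : T -> 'M[R]_(m, k)) : 'M[R]_(m, k) :=
  \matrix_(i, j) Rintegral P setT (fun w => Y w i j).

Definition covmx (m k : nat) (Y : T -> 'M[R]_(m, k)) : 'M[R]_(m * k) :=
  let zeta := fun w => mxvec (Y w - expectmx Y) in
  expectmx (fun w => (zeta w)^T *m zeta w).

Context (q : nat) (M : riemannian_manifold R q).

Definition mean_sq_dist (y : M) (Z : T -> M) : \bar R :=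
  (\int[P]_w (rho y (Z w) ^+ 2))%E.

Definition intrinsic_mean (Z : T -> M) (y : M) : Prop :=
  forall y', (mean_sq_dist y Z <= mean_sq_dist y' Z)%E.

Definition unique_intrinsic_mean (Z : T -> M) (y : M) : Prop :=
  intrinsic_mean Z y /\ forall y', intrinsic_mean Z y' -> y' = y.

End Probability.

Definition logmx (R : realType) (q N : nat) (M : topologicalType)
    (c : chart R q M) (z : 'I_N -> M) : 'M[R]_(N, q) :=
  \matrix_(j < N) cmap c (z j).

(* Main.v *)
Require Import Defs.
From HB Require Import structures.
From mathcomp Require Import all_boot all_order all_algebra.
From mathcomp Require Import all_classical all_reals all_analysis.
From mathcomp Require Import measurable_realfun.
From mathcomp Require Import ring lra.

Set Implicit Arguments.
Unset Strict Implicit.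
Unset Printing Implicit Defensive.

Import Order.TTheory GRing.Theory Num.Theory.
Import numFieldNormedType.Exports.

Local Open Scope classical_set_scope.
Local Open Scope ring_scope.

(** The proof compares everything with Euclidean quantities in the normal chart.

    Geometry.  In a normal chart the rays from the centre are geodesics, so the
    Christoffel symbols vanish radially.  This gives the Gauss lemma, and the
    Jacobi equation along a ray then shows, by two integrations and the bound on
    the curvature, that |g_z(v, v) - |v|^2| <= K |z|^2 |v|^2
    ([metric_second_order]).  On a ball of radius O(r) the coordinate segment
    bounds the geodesic distance from above.  Minimizing geodesics bound it from
    below, as strong convexity keeps them inside the ball.  Hence
    rho(x, y)^2 = (1 + O(r^2)) |log_p x - log_p y|^2
    ([normal_chart_distance_close]).

    Probability.  Fix x and write W = A u^eps + g for the logarithm of the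
    estimator.  For every point b of the tangent space, E |W - b|^2 is
    |E W - b|^2 + vs, where vs does not depend on b ([second_moment_about]).  By
    Cauchy-Schwarz vs = tr(A Sigma A^T) + O(r^3 sigma + r^6), because |g| = O(r^3)
    and the noise has size O(sigma).  The intrinsic mean enters through its
    minimality: wherever it lies, the variance is at least (1 - O(r^2)) vs, and it
    is at most the mean square distance to a point with logarithm close to E W
    ([var_close]).  For the mean square error take
    b = log_p F(x), which differs from E W by the approximation error e up to
    O(r^3 + sigma^2) ([mse_close]).

    Integration.  The estimates are uniform in x, and all functions of x involved
    are bounded and measurable.  The one term that is linear in |e| is integrated
    by Cauchy-Schwarz, which yields the square root of the integrated squared
    bias. *)

(** * The Euclidean norm and bilinear forms on rows *)

Section EuclideanNorm.
Context (R : realType) (m k : nat).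
Implicit Types u v w : 'M[R]_(m, k).

Lemma edotC v w : edot v w = edot w v.
Proof. by apply: eq_bigr => i _; apply: eq_bigr => j _; rewrite mulrC. Qed.

Lemma edotDl u v w : edot (u + v) w = edot u w + edot v w.
Proof.
rewrite /edot -big_split; apply: eq_bigr => i _.
by rewrite -big_split; apply: eq_bigr => j _; rewrite mxE mulrDl.
Qed.

Lemma edotZl a v w : edot (a *: v) w = a * edot v w.
Proof.
rewrite /edot mulr_sumr; apply: eq_bigr => i _.
by rewrite mulr_sumr; apply: eq_bigr => j _; rewrite mxE mulrA.
Qed.

Lemma edotDr u v w : edot u (v + w) = edot u v + edot u w.
Proof. by rewrite edotC edotDl !(edotC _ u). Qed.

Lemma edotZr a v w : edot v (a *: w) = a * edot v w.
Proof. by rewrite edotC edotZl edotC. Qed.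

Lemma edotNl v w : edot (- v) w = - edot v w.
Proof. by rewrite -scaleN1r edotZl mulN1r. Qed.

Lemma edotNr v w : edot v (- w) = - edot v w.
Proof. by rewrite -scaleN1r edotZr mulN1r. Qed.

Lemma edot0l v : edot 0 v = 0.
Proof. by rewrite -(scale0r v) edotZl mul0r. Qed.

Lemma edot_ge0 v : 0 <= edot v v.
Proof. by apply: sumr_ge0 => i _; apply: sumr_ge0 => j _; rewrite -expr2 sqr_ge0. Qed.

Lemma edot_sqr v : enorm v ^+ 2 = edot v v.
Proof. by rewrite sqr_sqrtr ?edot_ge0. Qed.

Lemma enorm_ge0 v : 0 <= enorm v.
Proof. exact: sqrtr_ge0. Qed.

Lemma edot_entry v i j : v i j ^+ 2 <= edot v v.
Proof.
rewrite /edot (bigD1 i)//= (bigD1 j)//= -expr2 -addrA lerDl.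
by rewrite addr_ge0//; [|apply: sumr_ge0 => i' _];
  apply: sumr_ge0 => j' _; rewrite -expr2 sqr_ge0.
Qed.

Lemma edot_eq0 v : (edot v v == 0) = (v == 0).
Proof.
apply/eqP/eqP => [v0|->]; last by rewrite edot0l.
apply/matrixP => i j; rewrite mxE; apply/eqP.
by rewrite -sqrf_eq0 eq_le sqr_ge0 -v0 edot_entry.
Qed.

Lemma cauchy_schwarz v w : edot v w ^+ 2 <= edot v v * edot w w.
Proof.
have [->|w0] := eqVneq w 0.
  by rewrite edotC edot0l edot0l expr0n /= mulr0.
have wp : 0 < edot w w by rewrite lt_neqAle edot_ge0 andbT eq_sym edot_eq0.
have := edot_ge0 (edot w w *: v - edot v w *: w).
rewrite !(edotDl, edotDr, edotNl, edotNr, edotZl, edotZr) (edotC w v) => h.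
have : 0 <= edot w w * (edot v v * edot w w - edot v w ^+ 2) by lra.
by rewrite pmulr_rge0// subr_ge0.
Qed.

Lemma edot_le v w : `|edot v w| <= enorm v * enorm w.
Proof.
rewrite -(ler_pXn2r (n := 2))// ?nnegrE ?mulr_ge0 ?enorm_ge0//.
by rewrite real_normK ?num_real// exprMn !edot_sqr cauchy_schwarz.
Qed.

Lemma enormD v w : enorm (v + w) <= enorm v + enorm w.
Proof.
rewrite -(ler_pXn2r (n := 2))// ?nnegrE ?addr_ge0 ?enorm_ge0//.
rewrite edot_sqr !(edotDl, edotDr) (edotC w v) sqrrD !edot_sqr.
have := edot_le v w; rewrite ler_norml => /andP[_]; lra.
Qed.

Lemma enormZ a v : enorm (a *: v) = `|a| * enorm v.
Proof.
by rewrite /enorm edotZl edotZr mulrA -expr2 sqrtrM ?sqr_ge0// sqrtr_sqr.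
Qed.

Lemma enormN v : enorm (- v) = enorm v.
Proof. by rewrite -scaleN1r enormZ normrN1 mul1r. Qed.

Lemma enorm0 : enorm (0 : 'M[R]_(m, k)) = 0.
Proof. by rewrite /enorm edot0l sqrtr0. Qed.

Lemma enormB v w : enorm (v - w) <= enorm v + enorm w.
Proof. by rewrite -(enormN w) enormD. Qed.

Lemma enorm_entry v i j : `|v i j| <= enorm v.
Proof.
rewrite -(ler_pXn2r (n := 2))// ?nnegrE ?enorm_ge0//.
by rewrite real_normK ?num_real// edot_sqr edot_entry.
Qed.

Lemma enorm_le v b : 0 <= b -> edot v v <= b ^+ 2 -> enorm v <= b.
Proof.
by move=> b0 vb; rewrite -(ler_pXn2r (n := 2))// ?nnegrE ?enorm_ge0// edot_sqr.
Qed.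

Lemma edot_le_sqr v b : enorm v <= b -> edot v v <= b ^+ 2.
Proof.
move=> vb; rewrite -edot_sqr; apply: lerXn2r => //; rewrite nnegrE ?enorm_ge0//.
exact: le_trans (enorm_ge0 _) vb.
Qed.

End EuclideanNorm.

Section Row.
Context (R : realType) (q : nat).
Local Notation V := 'rV[R]_q.

Lemma edot_row (v w : V) : edot v w = \sum_j v 0 j * w 0 j.
Proof. by rewrite /edot big_ord1. Qed.

(** The metric and each component of the Christoffel symbols are bilinear forms
    with varying coefficients, so one product rule, [is_derive_bil], serves all
    derivatives along curves. *)
Definition bil (B : 'I_q -> 'I_q -> R) (b c : V) : R :=
  \sum_j \sum_k B j k * b 0 j * c 0 k.

Lemma bilDl B b1 b2 c : bil B (b1 + b2) c = bil B b1 c + bil B b2 c.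
Proof.
rewrite /bil -big_split; apply: eq_bigr => j _; rewrite -big_split.
by apply: eq_bigr => k _; rewrite mxE /=; ring.
Qed.

Lemma bilZl B a b c : bil B (a *: b) c = a * bil B b c.
Proof.
rewrite /bil mulr_sumr; apply: eq_bigr => j _; rewrite mulr_sumr.
by apply: eq_bigr => k _; rewrite mxE /=; ring.
Qed.

Lemma bil_flip B b c : bil B b c = bil (fun j k => B k j) c b.
Proof.
rewrite /bil exchange_big; apply: eq_bigr => j _; apply: eq_bigr => k _; ring.
Qed.

Lemma bilDr B b c1 c2 : bil B b (c1 + c2) = bil B b c1 + bil B b c2.
Proof. by rewrite bil_flip bilDl (bil_flip B b c1) (bil_flip B b c2). Qed.

Lemma bilZr B a b c : bil B b (a *: c) = a * bil B b c.
Proof. by rewrite bil_flip bilZl (bil_flip B b c). Qed.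

Lemma bilC B b c : (forall j k, B j k = B k j) -> bil B b c = bil B c b.
Proof.
by move=> Bs; rewrite bil_flip; apply: eq_bigr => j _; apply: eq_bigr => k _; rewrite Bs.
Qed.

Lemma gdotE (G : V -> 'M[R]_q) y v w : gdot G y v w = bil (fun j k => G y j k) v w.
Proof.
rewrite /gdot mxE [RHS]exchange_big; apply: eq_bigr => k _.
rewrite !mxE mulr_suml; apply: eq_bigr => j _; ring.
Qed.

Lemma GammaE (G : V -> 'M[R]_q) y v w l :
  Gamma G y v w 0 l = bil (fun i j => christoffel G l i j y) v w.
Proof. by rewrite mxE. Qed.

Lemma derive_pderiv (f : V -> R) y a : differentiable f y ->
  'D_a f y = \sum_i a 0 i * pderiv i f y.
Proof.
move=> df; rewrite deriveE// {1}(row_sum_delta a) linear_sum.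
by apply: eq_bigr => i _; rewrite linearZ /pderiv -deriveE.
Qed.

Lemma deriveZv (f : V -> R) y t a : differentiable f y ->
  'D_(t *: a) f y = t * 'D_a f y.
Proof. by move=> df; rewrite !deriveE// linearZ. Qed.

End Row.

(** * Derivatives along curves *)

Section Differentiation.
Context (R : realType).

Lemma is_derive_line (V W : normedModType R) (f : V -> W) (z a : V) (t : R) :
  differentiable f (z + t *: a) ->
  is_derive t (1 : R) (fun s => f (z + s *: a)) ('D_a f (z + t *: a)).
Proof.
move=> df.
have dl : differentiable (fun s : R => z + s *: a) t.
  by apply: differentiableD => //; exact: differentiableZl.
have dfl : differentiable (fun s : R => f (z + s *: a)) t.
  exact: (@differentiable_comp _ _ _ _ (fun s : R => z + s *: a) f).
apply: DeriveDef; first exact/derivable1_diffP.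
rewrite [LHS]deriveE// (_ : (fun s : R => f _) = f \o (fun s : R => z + s *: a))//.
rewrite diff_comp//= deriveE//; congr ('d f _ _).
have := @is_diffD R _ _ (cst z) ( *:%R^~ a : R -> V) _ _ t
  (is_diff_cst z t) (is_diff_scalel t a).
rewrite add0r => -[_ h].
by rewrite (_ : (fun s : R => z + s *: a) = cst z + ( *:%R^~ a : R -> V))// h scale1r.
Qed.

Lemma is_derive_curve (V W : normedModType R) (f : V -> W) (u : R -> V) (t : R) :
  derivable u t 1 -> differentiable f (u t) ->
  is_derive t (1:R) (fun s => f (u s)) ('d f (u t) ('D_1 u t)).
Proof.
move=> /derivable1_diffP du df.
have dfu : differentiable (fun s : R => f (u s)) t.
  exact: (@differentiable_comp _ _ _ _ u f).
apply: DeriveDef; first exact/derivable1_diffP.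
rewrite [LHS]deriveE// (_ : (fun s : R => f _) = f \o u)// diff_comp//=.
by rewrite (deriveE _ du).
Qed.

Lemma is_derive_rescale (W : normedModType R) (f : R -> W) (a t : R) :
  derivable f (a * t) 1 ->
  is_derive t (1:R) (fun s => f (a * s)) (a *: 'D_1 f (a * t)).
Proof.
move=> /derivable1_diffP df.
have := @is_derive_line _ _ f 0 a t; rewrite add0r [t *: a]mulrC => /(_ df).
have -> : 'D_a f (a * t) = a *: 'D_1 f (a * t).
  by rewrite !deriveE// -linearZ; congr ('d f _ _); exact: esym (mulr1 a).
by congr (is_derive _ _ _ _); apply/funext => s; rewrite add0r [s *: a]mulrC.
Qed.

Lemma near_continuous (T U : topologicalType) (f : T -> U) (x : T) (Q : U -> Prop) :
  {for x, continuous f} -> (\forall y \near f x, Q y) -> \forall y \near x, Q (f y).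
Proof. by move=> cf; exact: cf. Qed.

Lemma near_eq_continuous (T U : topologicalType) (f g : T -> U) (x : T) :
  (\near x, f x = g x) -> {for x, continuous f} -> {for x, continuous g}.
Proof.
move=> fg cf; rewrite /prop_for /continuous_at -(nbhs_singleton fg).
by apply: cvg_trans cf; exact: near_eq_cvg.
Qed.

End Differentiation.

Section Lines.
Context (R : realType) (q : nat).
Local Notation V := 'rV[R]_q.

Lemma is_derive_bil (B : R -> 'I_q -> 'I_q -> R) (B' : 'I_q -> 'I_q -> R)
    (b c : R -> V) (b' c' : V) (t : R) :
  (forall j k, is_derive t (1:R) (fun s => B s j k) (B' j k)) ->
  (forall j, is_derive t (1:R) (fun s => b s 0 j) (b' 0 j)) ->
  (forall j, is_derive t (1:R) (fun s => c s 0 j) (c' 0 j)) ->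
  is_derive t (1:R) (fun s => bil (B s) (b s) (c s))
    (bil B' (b t) (c t) + bil (B t) b' (c t) + bil (B t) (b t) c').
Proof.
move=> dB db dc.
pose h (j : 'I_q) : R -> R := \sum_(k < q) (fun s => B s j k * b s 0 j * c s 0 k).
rewrite (_ : (fun s => _) = \sum_(j < q) h j); last first.
  by apply/funext => s; rewrite fct_sumE; apply: eq_bigr => j _; rewrite /h fct_sumE.
have <- : \sum_j \sum_k (B' j k * b t 0 j * c t 0 k + B t j k * b' 0 j * c t 0 k
    + B t j k * b t 0 j * c' 0 k)
    = bil B' (b t) (c t) + bil (B t) b' (c t) + bil (B t) (b t) c'.
  rewrite /bil -!big_split/=; apply: eq_bigr => j _; rewrite -!big_split/=.
  by apply: eq_bigr => k _; ring.
apply: is_derive_sum => j; apply: is_derive_sum => k.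
have /is_derive_eq := is_deriveM (is_deriveM (dB j k) (db j)) (dc k).
by apply; rewrite !fctE /GRing.scale/=; ring.
Qed.

Lemma is_derive_affine (z a : V) t j :
  is_derive t (1:R) (fun s => (z + s *: a) 0 j) (a 0 j).
Proof.
under eq_fun do rewrite !mxE.
have /is_derive_eq := is_deriveD (is_derive_cst (z 0 j) t (1:R))
  (is_deriveM (is_derive_id t (1:R)) (is_derive_cst (a 0 j) t (1:R))).
by apply; rewrite scaler0 !add0r [LHS]mulr1.
Qed.

Lemma mean_value_bound (f f' : R -> R) (K : R) (t : R) : 0 < t ->
  (forall s, 0 <= s <= t -> is_derive s (1:R) f (f' s)) ->
  (forall s, 0 < s < t -> `|f' s| <= K) ->
  `|f t - f 0| <= K * t.
Proof.
move=> t0 df f'K.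
have [s] : exists2 s, s \in `]0, t[%R & f t - f 0 = f' s * (t - 0).
  apply: MVT => // [s|].
    by rewrite in_itv/= => /andP[/ltW s0 /ltW st]; apply: df; rewrite s0.
  apply/continuous_in_subspaceT => s; rewrite inE/= in_itv/= => /df[dfs _].
  exact/differentiable_continuous/derivable1_diffP.
rewrite in_itv/= => /f'K fs ->.
by rewrite subr0 normrM (gtr0_norm t0) ler_wpM2r// ltW.
Qed.

Lemma derive1_0_eq (f f' : R -> R) :
  (forall s : R, 0 <= s <= 1 -> is_derive s (1:R) f (f' s)) ->
  (forall s : R, 0 < s < 1 -> f' s = 0) -> f 1 = f 0.
Proof.
move=> df f'0; apply/eqP; rewrite -subr_eq0 -normr_le0.
have := @mean_value_bound f f' 0 1 ltr01 df; rewrite mul0r; apply => s /f'0 ->.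
by rewrite normr0.
Qed.

Lemma is_derive_unique (f : R -> R) (t a b : R) :
  is_derive t (1:R) f a -> is_derive t (1:R) f b -> a = b.
Proof. by move=> [_ <-] [_ <-]. Qed.

Lemma edot_bil (v w : V) : edot v w = bil (fun j k => (j == k)%:R) v w.
Proof.
rewrite edot_row; apply: eq_bigr => j _; rewrite (bigD1 j)//= eqxx mul1r.
by rewrite big1 ?addr0// => k /negPf kj; rewrite eq_sym kj !mul0r.
Qed.

Lemma is_derive_edot (b c : R -> V) (b' c' : V) (t : R) :
  (forall j, is_derive t (1:R) (fun s => b s 0 j) (b' 0 j)) ->
  (forall j, is_derive t (1:R) (fun s => c s 0 j) (c' 0 j)) ->
  is_derive t (1:R) (fun s => edot (b s) (c s)) (edot b' (c t) + edot (b t) c').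
Proof.
move=> db dc; under eq_fun do rewrite edot_bil.
rewrite !edot_bil.
have d0 (j k : 'I_q) : is_derive t (1:R) (fun=> (j == k)%:R : R) 0.
  exact: is_derive_cst.
have := is_derive_bil d0 db dc.
rewrite [X in X + _ + _](_ : bil _ _ _ = 0) ?add0r//.
by rewrite /bil big1// => j _; rewrite big1// => k _; rewrite !mul0r.
Qed.

Lemma is_derive_entry_cst (v : V) t j : is_derive t (1:R) (fun=> v 0 j) ((0 : V) 0 j).
Proof. by rewrite mxE; exact: is_derive_cst. Qed.

End Lines.

Section NearDiff.
Context (R : realType) (V W : normedModType R).

Lemma near_eq_differentiable (f g : V -> W) (x : V) :
  (\near x, f x = g x) -> differentiable f x -> differentiable g x.
Proof.
move=> fg df; have dfc : continuous ('d f x) by exact: diff_continuous.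
have dfo := diff_locally df.
have go : g \o shift x = cst (g x) + 'd f x +o_ (0 : V) id.
  apply/eqaddoP => _/posnumP[e].
  move/eqaddoP : dfo => /(_ e%:num (gt0 e)) dfo.
  have fgs : \forall h \near (0:V), f (h + x) = g (h + x).
    by move: fg; rewrite (near_shift 0 x) subr0; apply: filterS => h.
  near=> h.
  have : `|(f \o shift x - (cst (f x) + 'd f x)) h| <= e%:num * `|id h|.
    by near: h; exact: dfo.
  by rewrite !fctE/= (near fgs h)// (nbhs_singleton fg).
apply/diff_locallyP; rewrite (diff_unique dfc go); split => //.
Unshelve. all: by end_near. Qed.
End NearDiff.

Section DiffMatrix.
Context (R : realType) (V : normedModType R).

Lemma differentiable_bigsum (I : Type) (s : seq I) (Q : pred I) (f : I -> V -> R) x :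
  (forall i, differentiable (f i) x) ->
  differentiable (fun y => \sum_(i <- s | Q i) f i y) x.
Proof.
move=> df; elim: s => [|i s ih].
  by under eq_fun do rewrite big_nil; exact: (differentiable_cst (0:R)).
under eq_fun do rewrite big_cons; case: (Q i) => //.
exact: (@differentiableD _ _ _ (f i) _ x (df i) ih).
Qed.

Lemma differentiable_bigprod (I : Type) (s : seq I) (Q : pred I) (f : I -> V -> R) x :
  (forall i, differentiable (f i) x) ->
  differentiable (fun y => \prod_(i <- s | Q i) f i y) x.
Proof.
move=> df; elim: s => [|i s ih].
  by under eq_fun do rewrite big_nil; exact: (differentiable_cst (1:R)).
under eq_fun do rewrite big_cons; case: (Q i) => //.
exact: (@differentiableM _ _ (f i) _ x (df i) ih).
Qed.

Lemma differentiable_det n (A : V -> 'M[R]_n) x :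
  (forall i j, differentiable (fun y => A y i j : R) x) ->
  differentiable (fun y => \det (A y)) x.
Proof.
move=> dA; apply: differentiable_bigsum => s.
apply: (@differentiableM _ _ (cst _) _ x); first exact: differentiable_cst.
by apply: differentiable_bigprod.
Qed.

Lemma differentiable_invmx n (A : V -> 'M[R]_n) x :
  (forall i j, differentiable (fun y => A y i j : R) x) ->
  (\near x, A x \in unitmx) ->
  forall i j, differentiable (fun y => invmx (A y) i j : R) x.
Proof.
move=> dA uA i j.
apply: (@near_eq_differentiable _ _ _ (fun y => (\det (A y))^-1 * \adj (A y) i j)).
  by apply: filterS uA => y uy; rewrite /invmx uy !mxE.
apply: (@differentiableM _ _ (fun y => (\det (A y))^-1) (fun y => \adj (A y) i j)).
  apply: (@differentiableV _ _ (fun y => \det (A y))); first exact: differentiable_det.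
  by have := nbhs_singleton uA; rewrite unitmxE unitfE.
under eq_fun do rewrite mxE.
apply: (@differentiableM _ _ (cst _) _ x); first exact: differentiable_cst.
apply: differentiable_det => i' j'.
by under eq_fun do rewrite !mxE.
Qed.
End DiffMatrix.

Section Ball.
Context (R : realType) (q : nat).
Local Notation V := 'rV[R]_q.

Lemma continuous_enorm : continuous (@enorm R 1 q).
Proof.
move=> v; rewrite /enorm.
apply: (@continuous_comp _ _ _ (fun v : V => edot v v) (@Num.sqrt R));
  last exact: sqrt_continuous.
apply: differentiable_continuous; rewrite /edot.
apply: differentiable_bigsum => i; apply: differentiable_bigsum => j.
by apply: (@differentiableM _ _ (fun v : V => v i j) (fun v : V => v i j));
  exact: differentiable_coord.
Qed.

Lemma open_eball (rad : R) : open [set v : V | enorm v < rad].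
Proof.
have /continuousP/(_ _ (@open_lt _ rad)) := continuous_enorm; exact.
Qed.

End Ball.

(** * Christoffel symbols and curvature of a metric in coordinates *)

Section Metric.
Context (R : realType) (q : nat) (G : 'rV[R]_q -> 'M[R]_q) (U : set 'rV[R]_q).
Local Notation V := 'rV[R]_q.
Hypothesis openU : open U.
Hypothesis smoothG : forall i j, smooth_on U (fun y => G y i j : R).
Hypothesis symG : forall y, U y -> (G y)^T = G y.
Hypothesis posG : forall y, U y -> forall v : V, v != 0 -> 0 < gdot G y v v.

Let dG y j k : U y -> differentiable (fun z => G z j k : R) y.
Proof. by move=> Uy; exact: (smoothG j k [::] Uy). Qed.

Let nearU y : U y -> \forall z \near y, U z.
Proof. by move=> Uy; apply: open_nbhs_nbhs; split. Qed.

(** The first derivatives of the metric as a trilinear form in a direction and two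
    constant fields; the Koszul formula and the Gauss lemma are identities
    between its values. *)
Definition metric_der (y a b c : V) : R :=
  bil (fun j k => 'D_a (fun z => G z j k : R) y) b c.
Local Notation T := metric_der.

Lemma metric_sym_entry y j k : U y -> G y j k = G y k j.
Proof. by move=> Uy; rewrite -{1}symG// mxE. Qed.

Lemma gdotC y v w : U y -> gdot G y v w = gdot G y w v.
Proof. by move=> Uy; rewrite !gdotE; apply: bilC => j k; rewrite metric_sym_entry. Qed.

Lemma metric_derC y a b c : U y -> T y a b c = T y a c b.
Proof.
move=> Uy; apply: bilC => j k; apply: near_eq_derive.
by apply: filterS (nearU Uy) => z Uz; rewrite metric_sym_entry.
Qed.

Lemma metric_derZl y t a b c : U y -> T y (t *: a) b c = t * T y a b c.
Proof.
move=> Uy; rewrite /T /bil mulr_sumr; apply: eq_bigr => j _; rewrite mulr_sumr.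
by apply: eq_bigr => k _; rewrite deriveZv ?mulrA//; exact: dG.
Qed.

Lemma metric_derE y a b c : U y -> T y a b c =
  \sum_i \sum_j \sum_k pderiv i (fun z => G z j k : R) y * a 0 i * b 0 j * c 0 k.
Proof.
move=> Uy; rewrite exchange_big; apply: eq_bigr => j _.
rewrite exchange_big; apply: eq_bigr => k _.
rewrite derive_pderiv; last exact: dG.
by rewrite !mulr_suml; apply: eq_bigr => i _; rewrite (mulrC (a 0 i)).
Qed.

Lemma is_derive_gdot (z a : V) (b c : R -> V) (b' c' : V) (t : R) :
  U (z + t *: a) ->
  (forall j, is_derive t (1:R) (fun s => b s 0 j) (b' 0 j)) ->
  (forall j, is_derive t (1:R) (fun s => c s 0 j) (c' 0 j)) ->
  is_derive t (1:R) (fun s => gdot G (z + s *: a) (b s) (c s))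
    (T (z + t *: a) a (b t) (c t) + gdot G (z + t *: a) b' (c t)
     + gdot G (z + t *: a) (b t) c').
Proof.
move=> Uz db dc; rewrite !gdotE; under eq_fun do rewrite gdotE.
by apply: is_derive_bil => // j k; apply: is_derive_line; exact: dG.
Qed.

Lemma metric_unit y : U y -> G y \in unitmx.
Proof.
move=> Uy; rewrite unitmxE unitfE; apply/negP => /det0P[v v0 vG].
by have := posG Uy v0; rewrite /gdot vG mul0mx mxE ltxx.
Qed.

Lemma gdot_ge0 y v : U y -> 0 <= gdot G y v v.
Proof.
move=> Uy; have [->|v0] := eqVneq v 0; last exact/ltW/posG.
by rewrite /gdot mul0mx mul0mx mxE.
Qed.

Lemma gnorm_sqr y v : U y -> Defs.gnorm G y v ^+ 2 = gdot G y v v.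
Proof. by move=> Uy; rewrite sqr_sqrtr// gdot_ge0. Qed.

(** The Koszul formula for coordinate fields, whose brackets vanish. *)
Lemma gdot_Gamma y v w b : U y ->
  gdot G y (Gamma G y v w) b = 2^-1 * (T y v w b + T y w v b - T y b v w).
Proof.
move=> Uy.
pose s : V := \row_l \sum_i \sum_j
  (pderiv i (fun z => G z j l : R) y + pderiv j (fun z => G z i l : R) y
   - pderiv l (fun z => G z i j : R) y) * v 0 i * w 0 j.
have -> : Gamma G y v w = 2^-1 *: (s *m invmx (G y)).
  apply/rowP => k; rewrite !mxE mulr_sumr.
  under [RHS]eq_bigr => l _.
    rewrite mxE mulr_suml mulr_sumr.
    under eq_bigr do rewrite mulr_suml mulr_sumr.
    over.
  rewrite [RHS]exchange_big; apply: eq_bigr => i _.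
  rewrite [RHS]exchange_big; apply: eq_bigr => j _.
  rewrite /christoffel !mulr_sumr !mulr_suml; apply: eq_bigr => l _.
  have -> : invmx (G y) l k = invmx (G y) k l.
    by rewrite -[in LHS](symG Uy) -trmx_inv mxE.
  by rewrite /=; ring.
rewrite /gdot -!scalemxAl mxE mulmxKV ?metric_unit//.
congr (_ * _); rewrite mxE.
rewrite !metric_derE//.
have rot (f : 'I_q -> 'I_q -> 'I_q -> R) :
    \sum_l \sum_i \sum_j f l i j = \sum_i \sum_j \sum_l f l i j.
  by rewrite exchange_big; apply: eq_bigr => i _; rewrite exchange_big.
rewrite [X in _ + X - _]exchange_big [X in _ - X]rot -big_split -sumrB/=.
under eq_bigr do rewrite !mxE mulr_suml; rewrite exchange_big.
apply: eq_bigr => i _; rewrite -big_split -sumrB/=.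
under eq_bigr do rewrite mulr_suml; rewrite exchange_big.
apply: eq_bigr => j _; rewrite -big_split -sumrB/=.
by apply: eq_bigr => l _; ring.
Qed.

Lemma differentiable_christoffel k i j y : U y ->
  differentiable (fun z => christoffel G k i j z : R) y.
Proof.
move=> Uy; apply: (@differentiableM _ _ (cst _) _ y); first exact: differentiable_cst.
apply: differentiable_bigsum => l.
have dp a b c : differentiable (fun z => pderiv a (fun w => G w b c : R) z) y.
  exact: (smoothG b c [:: a] Uy).
apply: (@differentiableM _ _ (fun z => invmx (G z) k l)
  (fun z => pderiv i (fun w => G w j l : R) z + pderiv j (fun w => G w i l : R) z
            - pderiv l (fun w => G w i j : R) z)).
  apply: differentiable_invmx => [? ?|]; first exact: dG.
  by apply: filterS (nearU Uy) => z; exact: metric_unit.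
apply: (@differentiableB _ _ _ (fun z => pderiv i (fun w => G w j l : R) z +
  pderiv j (fun w => G w i l : R) z) (fun z => pderiv l (fun w => G w i j : R) z)) => //.
exact: (@differentiableD _ _ _ (fun z => pderiv i (fun w => G w j l : R) z)
  (fun z => pderiv j (fun w => G w i l : R) z)).
Qed.

Lemma christoffelC k i j y : U y -> christoffel G k i j y = christoffel G k j i y.
Proof.
move=> Uy; congr (_ * _); apply: eq_bigr => l _; congr (_ * _).
rewrite [X in X - _]addrC; congr (_ - _); apply: near_eq_derive.
by apply: filterS (nearU Uy) => z Uz; rewrite metric_sym_entry.
Qed.

Lemma GammaC y v w : U y -> Gamma G y v w = Gamma G y w v.
Proof.
by move=> Uy; apply/rowP => l; rewrite !GammaE; apply: bilC => i j; rewrite christoffelC.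
Qed.

Lemma GammaDl y v1 v2 w : Gamma G y (v1 + v2) w = Gamma G y v1 w + Gamma G y v2 w.
Proof. by apply/rowP => l; rewrite [RHS]mxE !GammaE bilDl. Qed.

Lemma GammaDr y v w1 w2 : Gamma G y v (w1 + w2) = Gamma G y v w1 + Gamma G y v w2.
Proof. by apply/rowP => l; rewrite [RHS]mxE !GammaE bilDr. Qed.

Lemma GammaZl y t v w : Gamma G y (t *: v) w = t *: Gamma G y v w.
Proof. by apply/rowP => l; rewrite [RHS]mxE !GammaE bilZl. Qed.

Lemma GammaZr y t v w : Gamma G y v (t *: w) = t *: Gamma G y v w.
Proof. by apply/rowP => l; rewrite [RHS]mxE !GammaE bilZr. Qed.

(** A coordinate derivative, not a covariant one: the quadratic terms of the
    curvature tensor appear separately in [riemannE]. *)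
Definition Gamma_der (y a v w : V) : V :=
  \row_l bil (fun i j => 'D_a (fun z => christoffel G l i j z : R) y) v w.

Lemma Gamma_derC y a v w : U y -> Gamma_der y a v w = Gamma_der y a w v.
Proof.
move=> Uy; apply/rowP => l; rewrite !mxE; apply: bilC => i j.
by apply: near_eq_derive; apply: filterS (nearU Uy) => z; exact: christoffelC.
Qed.

Lemma is_derive_Gamma (z a : V) (b c : R -> V) (b' c' : V) (t : R) l :
  U (z + t *: a) ->
  (forall j, is_derive t (1:R) (fun s => b s 0 j) (b' 0 j)) ->
  (forall j, is_derive t (1:R) (fun s => c s 0 j) (c' 0 j)) ->
  is_derive t (1:R) (fun s => Gamma G (z + s *: a) (b s) (c s) 0 l)
    ((Gamma_der (z + t *: a) a (b t) (c t) + Gamma G (z + t *: a) b' (c t)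
     + Gamma G (z + t *: a) (b t) c') 0 l).
Proof.
move=> Uz db dc; under eq_fun do rewrite GammaE.
have -> (A B D : V) : (A + B + D) 0 l = A 0 l + B 0 l + D 0 l by rewrite !mxE.
rewrite !GammaE [Gamma_der _ _ _ _ 0 l]mxE.
have dB j k : is_derive t (1:R) (fun s => christoffel G l j k (z + s *: a))
    ('D_a (christoffel G l j k) (z + t *: a)).
  exact: (is_derive_line (differentiable_christoffel _ _ _ Uz)).
exact: is_derive_bil dB db dc.
Qed.

Lemma riemannE y v w z : U y -> riemann G y v w z =
  Gamma_der y v w z - Gamma_der y w v z
  + Gamma G y v (Gamma G y w z) - Gamma G y w (Gamma G y v z).
Proof.
move=> Uy; apply/rowP => l; rewrite [LHS]mxE.
have -> (A B D E : V) : (A - B + D - E) 0 l = A 0 l - B 0 l + D 0 l - E 0 l.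
  by rewrite !mxE.
have derE a b c : Gamma_der y a b c 0 l =
    \sum_i \sum_j \sum_k pderiv i (christoffel G l j k) y * a 0 i * b 0 j * c 0 k.
  rewrite mxE exchange_big; apply: eq_bigr => j _.
  rewrite exchange_big; apply: eq_bigr => k _.
  rewrite derive_pderiv; last exact: differentiable_christoffel.
  by rewrite !mulr_suml; apply: eq_bigr => i _; rewrite (mulrC (a 0 i)).
have GGE a b c : Gamma G y a (Gamma G y b c) 0 l =
    \sum_i \sum_j \sum_k (\sum_m christoffel G l i m y * christoffel G m j k y)
       * a 0 i * b 0 j * c 0 k.
  rewrite mxE; apply: eq_bigr => i _.
  under eq_bigr => m _.
    rewrite mxE mulr_sumr.
    under eq_bigr do rewrite mulr_sumr.
    over.
  rewrite exchange_big; apply: eq_bigr => j _.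
  rewrite exchange_big; apply: eq_bigr => k _.
  by rewrite !mulr_suml; apply: eq_bigr => m _; ring.
rewrite !derE !GGE.
rewrite [X in _ - X + _ - _]exchange_big [X in _ - X]exchange_big.
rewrite -sumrB -big_split -sumrB/=; apply: eq_bigr => i _.
rewrite -sumrB -big_split -sumrB/=; apply: eq_bigr => j _.
rewrite -sumrB -big_split -sumrB/=; apply: eq_bigr => k _.
rewrite /riemann_tensor sumrB.
move: (pderiv i _ y) (pderiv j _ y) (\sum_m christoffel G l i m y * _)
  (\sum_m christoffel G l j m y * _) (v 0 i) (w 0 j) (z 0 k) => a b c d e f g.
ring.
Qed.

(** * The metric in normal coordinates *)

Section NormalCoordinates.
Variables (rad C : R).
Hypothesis ballU : forall v : V, enorm v < rad -> U v.
Hypothesis metric0 : G 0 = 1%:M.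
Hypothesis Gamma_radial : forall z : V, enorm z < rad -> Gamma G z z z = 0.

Local Notation D z := (enorm (z : V) < rad).

Let ballZ z (t : R) : D z -> 0 <= t <= 1 -> D (t *: z).
Proof.
move=> Dz /andP[t0 t1]; apply: le_lt_trans Dz.
by rewrite enormZ ger0_norm// ler_piMl// enorm_ge0.
Qed.

Let nearD z a : D z -> \forall s \near (0 : R), D (z + s *: a).
Proof.
move=> Dz.
have c0 : {for (0 : R), continuous (fun s : R => z + s *: a)}.
  apply: continuousD; first exact: cst_continuous.
  exact: scalel_continuous.
apply: (c0 [set y | enorm y < rad]) => /=.
apply: open_nbhs_nbhs; split; first exact: open_eball.
by rewrite /= scale0r addr0.
Qed.

Let line0 (z a : V) : z = z + 0 *: a. Proof. by rewrite scale0r addr0. Qed.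

Let gdot0l z b : gdot G z 0 b = 0.
Proof. by rewrite /gdot !mul0mx mxE. Qed.

Let gdot0r z b : gdot G z b 0 = 0.
Proof. by rewrite /gdot trmx0 mulmx0 mxE. Qed.

Lemma Gamma_ray z (t : R) : D z -> 0 < t <= 1 -> Gamma G (t *: z) z z = 0.
Proof.
move=> Dz /andP[t0 t1].
have Dt : D (t *: z) by apply: ballZ; rewrite // (ltW t0).
have := Gamma_radial Dt.
rewrite GammaZl GammaZr scalerA => /eqP.
by rewrite scaler_eq0 mulf_eq0 !(gt_eqF t0) => /eqP.
Qed.

Lemma metric_der_ray z (t : R) b : D z -> 0 < t <= 1 ->
  T (t *: z) z z b = 2^-1 * T (t *: z) b z z.
Proof.
move=> Dz /[dup] t01 /andP[t0 t1].
have Dt : D (t *: z) by apply: ballZ; rewrite // (ltW t0).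
have := gdot_Gamma z z b (ballU Dt); rewrite Gamma_ray// ?t0// gdot0l; lra.
Qed.

(** Radial geodesics have constant speed, so their speed at z equals that at the
    centre, where the metric is Euclidean. *)
Lemma gdot_radial z : D z -> gdot G z z z = edot z z.
Proof.
move=> Dz.
pose f t := gdot G (0 + t *: z) z z.
have f1 : f 1 = gdot G z z z by rewrite /f add0r scale1r.
have f0 : f 0 = edot z z.
  by rewrite /f add0r scale0r /gdot metric0 mulmx1 mxE edot_row;
     apply: eq_bigr => j _; rewrite mxE.
rewrite -f1 -f0; apply: (@derive1_0_eq _ f (fun s => T (0 + s *: z) z z z)) => s.
  move=> s01; have Us : U (0 + s *: z) by rewrite add0r; exact/ballU/ballZ.
  have := is_derive_gdot Us (is_derive_entry_cst z s) (is_derive_entry_cst z s).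
  by rewrite gdot0l gdot0r !addr0.
move=> /andP[s0 s1]; have s01 : 0 < s <= 1 by rewrite s0 ltW.
have := metric_der_ray z Dz s01; rewrite add0r.
lra.
Qed.

(** The derivative of [gdot_radial] in the direction b. *)
Let metric_der_radial1 z b : D z -> 2^-1 * T z b z z = edot z b - gdot G z z b.
Proof.
move=> Dz.
have Uz : U (z + 0 *: b) by rewrite -line0; exact: ballU.
have dl := is_derive_affine z b 0.
have h1 := is_derive_gdot Uz dl dl.
have h2 := is_derive_edot dl dl.
have {}h1 : is_derive (0:R) (1:R) (fun s => edot (z + s *: b) (z + s *: b))
    (T (z + 0 *: b) b (z + 0 *: b) (z + 0 *: b) + gdot G (z + 0 *: b) b (z + 0 *: b)
     + gdot G (z + 0 *: b) (z + 0 *: b) b).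
  apply: near_eq_is_derive h1.
  by apply: filterS (nearD b Dz) => s; exact: gdot_radial.
have := is_derive_unique h1 h2; rewrite -!line0 (edotC b z).
rewrite (gdotC b z (ballU Dz)); lra.
Qed.

(** The Gauss lemma.  The defect t (g(z, b) - <z, b>) at the point t z is constant
    in t: its derivative combines the geodesic equation along the ray with
    [metric_der_radial1], and it vanishes at t = 0. *)
Lemma gauss_lemma z b : D z -> gdot G z z b = edot z b.
Proof.
move=> Dz.
pose f t := t * (gdot G (0 + t *: z) z b - edot z b).
suff : f 1 = f 0 by rewrite /f mul1r mul0r add0r scale1r => /eqP; rewrite subr_eq0 => /eqP.
apply: (@derive1_0_eq _ f (fun t => (gdot G (0 + t *: z) z b - edot z b)
    + t * T (0 + t *: z) z z b)) => t.
  move=> t01; have Ut : U (0 + t *: z) by rewrite add0r; exact/ballU/ballZ.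
  have h := is_derive_gdot Ut (is_derive_entry_cst z t) (is_derive_entry_cst b t).
  rewrite gdot0l gdot0r !addr0 in h.
  have /is_derive_eq := is_deriveM (is_derive_id t (1:R))
    (is_deriveB h (is_derive_cst (edot z b) t (1:R))).
  by apply; rewrite !fctE /GRing.scale/=; ring.
move=> /andP[t0 t1]; rewrite add0r.
have t01 : 0 <= t <= 1 by rewrite !ltW.
rewrite metric_der_ray ?t0 ?ltW//.
have := metric_der_radial1 b (ballZ Dz t01).
rewrite /T bilZl bilZr edotZl gdotE bilZl -gdotE -/(T _ b z z) => h.
apply: (mulfI (lt0r_neq0 t0)); rewrite mulr0; lra.
Qed.

(** Obtained by differentiating the Gauss lemma.  The point is that the
    right-hand side is symmetric in a and b. *)
Lemma metric_der_radial z a b : D z -> T z a z b = edot a b - gdot G z a b.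
Proof.
move=> Dz.
have Uz : U (z + 0 *: a) by rewrite -line0; exact: ballU.
have dl := is_derive_affine z a 0.
have h1 := is_derive_gdot Uz dl (is_derive_entry_cst b 0).
have h2 := is_derive_edot dl (is_derive_entry_cst b 0).
have {}h1 : is_derive (0:R) (1:R) (fun s => edot (z + s *: a) b)
    (T (z + 0 *: a) a (z + 0 *: a) b + gdot G (z + 0 *: a) a b
     + gdot G (z + 0 *: a) (z + 0 *: a) 0).
  apply: near_eq_is_derive h1.
  by apply: filterS (nearD a Dz) => s; exact: gauss_lemma.
have := is_derive_unique h1 h2; rewrite -!line0 gdot0r (edotC z 0) edot0l.
lra.
Qed.

(** Two of the three Koszul terms cancel by the symmetry just obtained. *)
Lemma gdot_Gamma_radial z v w : D z -> gdot G z (Gamma G z z v) w = 2^-1 * T z z v w.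
Proof.
move=> Dz; have Uz := ballU Dz; rewrite gdot_Gamma// (metric_derC w z v Uz).
rewrite (metric_der_radial v w Dz) (metric_derC w v z Uz) (metric_der_radial w v Dz).
rewrite (edotC w v) (gdotC w v Uz); lra.
Qed.

Lemma gdot_Gamma_ray z (t : R) v w : D z -> 0 < t <= 1 ->
  gdot G (t *: z) (Gamma G (t *: z) z v) w = 2^-1 * T (t *: z) z v w.
Proof.
move=> Dz /andP[t0 t1].
have Dt : D (t *: z) by apply: ballZ; rewrite // (ltW t0).
have := gdot_Gamma_radial v w Dt; rewrite metric_derZl; last exact: ballU.
rewrite GammaZl !gdotE bilZl mulrCA => /mulfI; apply.
exact: lt0r_neq0.
Qed.

Lemma gdot_ray z (t : R) : D z -> 0 < t <= 1 -> gdot G (t *: z) z z = edot z z.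
Proof.
move=> Dz /andP[t0 t1].
have Dt : D (t *: z) by apply: ballZ; rewrite // (ltW t0).
have := gdot_radial Dt; rewrite gdotE bilZl bilZr -gdotE edotZl edotZr.
by move=> /(mulfI (lt0r_neq0 t0))/(mulfI (lt0r_neq0 t0)).
Qed.

Hypothesis C_gt0 : 0 < C.
Hypothesis chart_der1 : forall y v : V, D y -> enorm v <= C * Defs.gnorm G y v.
Hypothesis chart_der2 : forall y v : V, D y ->
  enorm (Gamma G y v v) <= C * Defs.gnorm G y v ^+ 2.

Let gdotDl y a b c : gdot G y (a + b) c = gdot G y a c + gdot G y b c.
Proof. by rewrite !gdotE bilDl. Qed.
Let gdotDr y a b c : gdot G y a (b + c) = gdot G y a b + gdot G y a c.
Proof. by rewrite !gdotE bilDr. Qed.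
Let gdotZl y t a b : gdot G y (t *: a) b = t * gdot G y a b.
Proof. by rewrite !gdotE bilZl. Qed.
Let gdotZr y t a b : gdot G y a (t *: b) = t * gdot G y a b.
Proof. by rewrite !gdotE bilZr. Qed.

Let Gamma0l y v : Gamma G y 0 v = 0.
Proof. by rewrite -(scale0r (0 : V)) GammaZl !scale0r. Qed.
Let Gamma0r y v : Gamma G y v 0 = 0.
Proof. by rewrite -(scale0r (0 : V)) GammaZr !scale0r. Qed.

Let Gamma_bound_sum y a b : D y ->
  enorm (Gamma G y a b) <= C / 2 * (gdot G y a a + gdot G y b b).
Proof.
move=> Dy; have Uy := ballU Dy.
have h1 := chart_der2 (a + b) Dy; have h2 := chart_der2 (a - b) Dy.
rewrite gnorm_sqr// in h1; rewrite gnorm_sqr// in h2.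
have e4 : 4 *: Gamma G y a b = Gamma G y (a + b) (a + b) - Gamma G y (a - b) (a - b).
  rewrite -(scaleN1r b) !(GammaDl, GammaDr, GammaZl, GammaZr) (GammaC b a Uy).
  move: (Gamma G y a a) (Gamma G y a b) (Gamma G y b b) => A B E.
  by apply/rowP => l; rewrite !mxE; ring.
have : enorm (4 *: Gamma G y a b) <=
    enorm (Gamma G y (a + b) (a + b)) + enorm (Gamma G y (a - b) (a - b)).
  by rewrite e4 enormB.
rewrite enormZ ger0_norm// => h3.
have g4 : gdot G y (a + b) (a + b) + gdot G y (a - b) (a - b)
    = 2 * (gdot G y a a + gdot G y b b).
  by rewrite -(scaleN1r b) !(gdotDl, gdotDr, gdotZl, gdotZr); ring.
have : 4 * enorm (Gamma G y a b) <= C * (2 * (gdot G y a a + gdot G y b b)).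
  by rewrite -g4 mulrDr; apply: le_trans h3 _; exact: lerD.
lra.
Qed.

(** The diagonal bound on the Hessian of the chart gives a bilinear one by
    polarization, after balancing the norms of the two arguments. *)
Lemma Gamma_bound y a b : D y ->
  enorm (Gamma G y a b) <= C * (Defs.gnorm G y a * Defs.gnorm G y b).
Proof.
move=> Dy; have Uy := ballU Dy.
have gp (v : V) : v != 0 -> 0 < Defs.gnorm G y v.
  by move=> v0; rewrite /Defs.gnorm sqrtr_gt0 posG.
have g0 : Defs.gnorm G y 0 = 0 by rewrite /Defs.gnorm gdot0l sqrtr0.
have [->|a0] := eqVneq a 0.
  by rewrite Gamma0l enorm0 g0 mul0r mulr0.
have [->|b0] := eqVneq b 0.
  by rewrite Gamma0r enorm0 g0 !mulr0.
have := Gamma_bound_sum (Defs.gnorm G y b *: a) (Defs.gnorm G y a *: b) Dy.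
rewrite GammaZl GammaZr scalerA enormZ !(gdotZl, gdotZr) -!(gnorm_sqr _ Uy).
set na := Defs.gnorm G y a; set nb := Defs.gnorm G y b.
have na0 : 0 < na by exact: gp.
have nb0 : 0 < nb by exact: gp.
rewrite ger0_norm; last by rewrite mulr_ge0 ?(ltW na0) ?(ltW nb0).
move=> h.
have ab0 : 0 < nb * na by rewrite mulr_gt0.
rewrite -(ler_pM2l ab0); apply: le_trans h _.
rewrite le_eqVlt; apply/orP; left; by apply/eqP; field.
Qed.

Let gnorm_ge0 y v : 0 <= Defs.gnorm G y v. Proof. exact: sqrtr_ge0. Qed.

Hypothesis small : 4 * C ^+ 2 * rad <= 1.

(** The value of the inverse metric at (xi, xi) has derivative - 2 <Gamma(z, w), xi>
    along a ray, with w = G^-1 xi.  Here |w|_g is bounded by C |xi|, because |w|_g^2 = <w, xi> and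
    the chart has bounded derivative, so no bound on g itself is presupposed. *)
Let inv_metric_bound z (xi : V) : D z ->
  2^-1 * edot xi xi <= edot (xi *m invmx (G z)) xi.
Proof.
move=> Dz.
pose H (t : R) := invmx (G (0 + t *: z)).
pose w (t : R) : V := xi *m H t.
pose h (t : R) := edot (w t) xi.
pose w' (t : R) : V := \row_k \sum_j xi 0 j * 'D_z (fun y => invmx (G y) j k : R) (0 + t *: z).
have U01 (t : R) : 0 <= t <= 1 -> U (0 + t *: z) by move=> t01; rewrite add0r; exact/ballU/ballZ.
have dw (t : R) : 0 <= t <= 1 -> forall k, is_derive t (1:R) (fun s => w s 0 k) (w' t 0 k).
  move=> t01 k; rewrite mxE.
  rewrite (_ : (fun s => w s 0 k) = \sum_j (fun s => xi 0 j * H s j k)); last first.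
    by apply/funext => s; rewrite fct_sumE mxE.
  apply: is_derive_sum => j.
  have dH : differentiable (fun y => invmx (G y) j k : R) (0 + t *: z).
    apply: differentiable_invmx => [? ?|]; first exact/dG/U01.
    by apply: filterS (nearU (U01 _ t01)) => y; exact: metric_unit.
  exact: (is_deriveZ (xi 0 j) (is_derive_line dH)).
have wG (t : R) : 0 <= t <= 1 -> w t *m G (0 + t *: z) = xi.
  by move=> /U01 Ut; rewrite mulmxKV// metric_unit.
have gdot_w (t : R) v : 0 <= t <= 1 -> gdot G (0 + t *: z) (w t) v = edot xi v.
  move=> t01; rewrite /gdot wG// mxE edot_row.
  by apply: eq_bigr => j _; rewrite mxE.
have dh (t : R) : 0 <= t <= 1 -> is_derive t (1:R) h (edot (w' t) xi).
  move=> t01.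
  have := is_derive_edot (dw t t01) (is_derive_entry_cst xi t).
  by rewrite (edotC _ 0) edot0l addr0.
(* h = g(w, w) too, so h' = dg(w, w) + 2 h', whence h' = - dg(w, w) *)
have h'E (t : R) : 0 < t < 1 -> edot (w' t) xi = - T (0 + t *: z) z (w t) (w t).
  move=> /andP[t0 t1]; have t01 : 0 <= t <= 1 by rewrite !ltW.
  have := is_derive_gdot (U01 t t01) (dw t t01) (dw t t01).
  rewrite gdot_w// (gdotC _ _ (U01 t t01)) gdot_w// (edotC xi) => h1.
  have {}h1 := near_eq_is_derive
    (f := fun s : R => gdot G (0 + s *: z) (w s) (w s)) (g := h) _ h1.
  have /h1 {}h1 : \forall s \near t, gdot G (0 + s *: z) (w s) (w s) = h s.
    have : \forall s \near t, s \in `]0, 1[%R.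
      by apply: near_in_itvoo; rewrite in_itv/= t0.
    apply: filterS => s; rewrite in_itv/= => /andP[s0 s1].
    by rewrite gdot_w ?ltW// /h edotC.
  have := is_derive_unique h1 (dh t t01); lra.
have xi0 : 0 <= edot xi xi by exact: edot_ge0.
have rz : enorm z <= rad by exact: ltW.
have : `|h 1 - h 0| <= 2 * C ^+ 2 * rad * edot xi xi * 1.
  apply: (mean_value_bound (f' := fun t => edot (w' t) xi)) => // t /[dup] t01 /andP[t0 t1].
  have Dt : D (t *: z) by apply: ballZ; rewrite ?ltW.
  have Ut := ballU Dt.
  have t01' : 0 <= t <= 1 by rewrite !ltW.
  have t01'' : 0 < t <= 1 by rewrite t0 ltW.
  rewrite h'E// normrN add0r.
  have -> : T (t *: z) z (w t) (w t) = 2 * gdot G (t *: z) (Gamma G (t *: z) z (w t)) (w t).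
    by rewrite gdot_Gamma_ray//; lra.
  rewrite gdotC// -{1}[t *: z]add0r gdot_w// normrM ger0_norm//.
  have nw : Defs.gnorm G (t *: z) (w t) <= C * enorm xi.
    have g2 := gnorm_sqr (w t) Ut; have := gdot_w t (w t) t01'; rewrite add0r => gw.
    rewrite gw in g2.
    have h1 := edot_le xi (w t); have h2 := chart_der1 (w t) Dt.
    have h3 : Defs.gnorm G (t *: z) (w t) ^+ 2 <= enorm xi * (C * Defs.gnorm G (t *: z) (w t)).
      rewrite g2; apply: le_trans (ler_norm _) _; apply: le_trans h1 _.
      by rewrite ler_wpM2l ?enorm_ge0.
    have [->|n0] := eqVneq (Defs.gnorm G (t *: z) (w t)) 0.
      by rewrite mulr_ge0 ?enorm_ge0 ?ltW.
    have np : 0 < Defs.gnorm G (t *: z) (w t) by rewrite lt_neqAle eq_sym n0 gnorm_ge0.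
    by rewrite -(ler_pM2l np) -expr2; apply: le_trans h3 _;
      rewrite le_eqVlt; apply/orP; left; apply/eqP; ring.
  have nz : Defs.gnorm G (t *: z) z = enorm z by rewrite /Defs.gnorm gdot_ray.
  have h1 := edot_le xi (Gamma G (t *: z) z (w t)).
  have h2 := Gamma_bound z (w t) Dt; rewrite nz in h2.
  have h3 : enorm (Gamma G (t *: z) z (w t)) <= C * (rad * (C * enorm xi)).
    apply: le_trans h2 _; rewrite ler_wpM2l ?(ltW C_gt0)//.
    by rewrite ler_pM ?enorm_ge0.
  rewrite -edot_sqr -!mulrA ler_wpM2l//; apply: le_trans h1 _.
  apply: le_trans (ler_wpM2l (enorm_ge0 _) h3) _.
  by rewrite le_eqVlt; apply/orP; left; apply/eqP; ring.
have -> : h 1 = edot (xi *m invmx (G z)) xi by rewrite /h /w /H add0r scale1r.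
have -> : h 0 = edot xi xi by rewrite /h /w /H add0r scale0r metric0 invmx1 mulmx1.
rewrite ler_norml => /andP[+ _].
have : 4 * C ^+ 2 * rad * edot xi xi <= 1 * edot xi xi by exact: ler_wpM2r.
lra.
Qed.

(** A crude upper bound on the metric, from the lower bound on its inverse: a direct
    estimate of g along rays would need the bound that it is meant to give. *)
Lemma gdot_le2 z (v : V) : D z -> gdot G z v v <= 2 * edot v v.
Proof.
move=> Dz; have Uz := ballU Dz.
have := inv_metric_bound (v *m G z) Dz; rewrite mulmxK ?metric_unit//.
have e1 : gdot G z v v = edot v (v *m G z).
  by rewrite /gdot mxE edotC edot_row; apply: eq_bigr => j _; rewrite [v^T _ _]mxE.
rewrite -e1 => h1.
have h2 : gdot G z v v <= enorm v * enorm (v *m G z).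
  by rewrite e1; apply: le_trans (ler_norm _) _; exact: edot_le.
rewrite -edot_sqr in h1; rewrite -edot_sqr.
have := enorm_ge0 v; have := enorm_ge0 (v *m G z).
move: h1 h2; set x := enorm _; set y := enorm _; set g := gdot _ _ _ _ => h1 h2 x0 y0.
have xy : x <= 2 * y.
  have [->|xn] := eqVneq x 0; first by rewrite mulr_ge0.
  have xp : 0 < x by rewrite lt_neqAle eq_sym xn.
  rewrite -(ler_pM2l xp); lra.
apply: le_trans h2 _; rewrite [leLHS]mulrC.
apply: le_trans (ler_wpM2r y0 xy) _; lra.
Qed.

Hypothesis sect_bound : forall y v w : V, D y -> `|sect G y v w| <= C.

Let riemann0 y z : riemann G y z z z = 0.
Proof.
apply/rowP => l; rewrite !mxE.
have anti i j k : riemann_tensor G l k i j y = - riemann_tensor G l k j i y.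
  rewrite /riemann_tensor !sumrB.
  move: (pderiv i _ y) (pderiv j _ y) (\sum_m _) (\sum_m _) => a b c e; ring.
set S := \sum_i _; suff : S = - S by lra.
rewrite {1}/S exchange_big /S -sumrN; apply: eq_bigr => i _; rewrite -sumrN.
apply: eq_bigr => j _; rewrite -sumrN; apply: eq_bigr => k _; rewrite anti; ring.
Qed.

Let riemannZl y t v w z : riemann G y (t *: v) w z = t *: riemann G y v w z.
Proof.
apply/rowP => l; rewrite !mxE mulr_sumr; apply: eq_bigr => i _.
rewrite mulr_sumr; apply: eq_bigr => j _; rewrite mulr_sumr; apply: eq_bigr => k _.
rewrite mxE; ring.
Qed.

(** The bound on the sectional curvature, multiplied out.  The quotient says nothing
    about dependent arguments, for which the left-hand side vanishes by the
    antisymmetry of the curvature tensor. *)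
Lemma curvature_bound y v z : D y ->
  `|gdot G y (riemann G y v z z) v| <= C * (gdot G y v v * gdot G y z z).
Proof.
move=> Dy; have Uy := ballU Dy.
have rhs0 : 0 <= C * (gdot G y v v * gdot G y z z).
  by rewrite mulr_ge0 ?(ltW C_gt0)// mulr_ge0 ?gdot_ge0.
have [z0|z0] := eqVneq z 0.
  suff -> : riemann G y v z z = 0 by rewrite gdot0l normr0.
  apply/rowP => l; rewrite !mxE z0 big1// => i _; rewrite big1// => j _; rewrite big1// => k _.
  by rewrite !mxE mulr0.
have zp := posG Uy z0.
pose u := gdot G y z z *: v - gdot G y v z *: z.
have uE : gdot G y u u = gdot G y z z *
    (gdot G y v v * gdot G y z z - gdot G y v z ^+ 2).
  rewrite /u -(scaleN1r (_ *: z)) !(gdotDl, gdotDr, gdotZl, gdotZr) (gdotC z v Uy); ring.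
have [u0|u0] := eqVneq u 0.
  have -> : v = (gdot G y v z / gdot G y z z) *: z.
    have /eqP := u0; rewrite subr_eq0 => /eqP/(congr1 ( *:%R (gdot G y z z)^-1)).
    by rewrite !scalerA mulVf ?gt_eqF// scale1r mulrC.
  by rewrite riemannZl riemann0 scaler0 gdot0l normr0 mulr_ge0 ?(ltW C_gt0)// mulr_ge0 ?gdot_ge0.
have := posG Uy u0; rewrite uE pmulr_rgt0// => den.
have := sect_bound v z Dy; rewrite /sect normrM normfV (gtr0_norm den) ler_pdivrMr//.
move=> h; apply: le_trans h _; rewrite ler_wpM2l ?(ltW C_gt0)//.
by rewrite lerBlDr lerDl sqr_ge0.
Qed.

Definition metric_const := 8 * C ^+ 2 + 4 * C.

(** Bounded curvature makes the metric Euclidean to second order.  With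
    a(t) = Gamma(z, v) at the point t z, one has d/dt g(v, v) = 2 g(a, v) along
    the ray, and the Jacobi equation for the field t v, paired with that field,
    becomes d/dt (t^2 g(a, v)) = t^2 (g(a, a) - g(R(v, z) z, v)).  The bracket is
    bounded, so two integrations give the claim. *)
Lemma metric_second_order z (v : V) : D z ->
  `|gdot G z v v - edot v v| <= metric_const * (edot z z * edot v v).
Proof.
move=> Dz.
pose a (t : R) : V := Gamma G (0 + t *: z) z v.
pose K := (4 * C ^+ 2 + 2 * C) * (edot z z * edot v v).
have zv0 : 0 <= edot z z * edot v v by rewrite mulr_ge0 ?edot_ge0.
have C2 : 0 <= C ^+ 2 by exact: sqr_ge0.
have U01 (t : R) : 0 <= t <= 1 -> U (0 + t *: z) by move=> t01; rewrite add0r; exact/ballU/ballZ.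
pose a' (t : R) : V := Gamma_der (0 + t *: z) z z v.
have da (t : R) : 0 <= t <= 1 -> forall l, is_derive t (1:R) (fun s => a s 0 l) (a' t 0 l).
  move=> t01 l.
  have := is_derive_Gamma l (U01 t t01) (is_derive_entry_cst z t) (is_derive_entry_cst v t).
  by rewrite Gamma0l Gamma0r !addr0.
pose P (t : R) := t ^+ 2 * gdot G (0 + t *: z) (a t) v.
pose P' (t : R) := 2 * t * gdot G (0 + t *: z) (a t) v + t ^+ 2 *
  (T (0 + t *: z) z (a t) v + gdot G (0 + t *: z) (a' t) v).
have dP (t : R) : 0 <= t <= 1 -> is_derive t (1:R) P (P' t).
  move=> t01.
  have := is_derive_gdot (U01 t t01) (da t t01) (is_derive_entry_cst v t).
  rewrite gdot0r addr0 => h.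
  have d2 : is_derive t (1:R) (fun s : R => s ^+ 2) (2 * t).
    by have /is_derive_eq := is_deriveX 2 (is_derive_id t (1:R)); apply;
      rewrite /GRing.scale/= expr1 mulr1 mulr_natl.
  have /is_derive_eq := is_deriveM d2 h.
  by apply; rewrite /P' /GRing.scale/=; ring.
have P'E (t : R) : 0 < t < 1 -> P' t = t ^+ 2 *
    (gdot G (t *: z) (a t) (a t) - gdot G (t *: z) (riemann G (t *: z) v z z) v).
  move=> /andP[t0 t1]; have t01 : 0 < t <= 1 by rewrite t0 ltW.
  have Dt : D (t *: z) by apply: ballZ; rewrite ?ltW.
  have Ut := ballU Dt.
  have aE : a t = Gamma G (t *: z) z v by rewrite /a add0r.
  have Tav : T (t *: z) z (a t) v = 2 * gdot G (t *: z) (a t) (a t).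
    rewrite {2}aE gdot_Gamma_ray// metric_derC//; lra.
  have Gav : gdot G (t *: z) (Gamma G (t *: z) z (a t)) v = gdot G (t *: z) (a t) (a t).
    by rewrite gdot_Gamma_ray// Tav; lra.
  (* differentiate Gamma(y)(y, y) = 0 at y = t z in the direction v *)
  have dG0 : t *: Gamma_der (t *: z) v z z = - 2 *: a t.
    apply/rowP => l.
    have Uv : U (t *: z + 0 *: v) by rewrite scale0r addr0.
    have dl := is_derive_affine (t *: z) v 0.
    have h1 := is_derive_Gamma l Uv dl dl.
    have h0 : is_derive (0:R) (1:R) (fun=> 0 : R) 0 by exact: is_derive_cst.
    have {}h1 := near_eq_is_derive (g := fun=> 0 : R) _ h1.
    have /h1 {}h1 : \forall s \near (0:R),
        Gamma G (t *: z + s *: v) (t *: z + s *: v) (t *: z + s *: v) 0 l = 0.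
      by apply: filterS (nearD v Dt) => s /Gamma_radial ->; rewrite mxE.
    have := is_derive_unique h1 h0.
    rewrite scale0r addr0 GammaZl GammaZr (GammaC v z Ut) -aE.
    have -> : Gamma_der (t *: z) v (t *: z) (t *: z) = (t * t) *: Gamma_der (t *: z) v z z.
      by apply/rowP => i; rewrite !mxE bilZl bilZr mulrA.
    rewrite !mxE => h.
    apply: (mulfI (lt0r_neq0 t0)); rewrite mulrA; lra.
  have rE : t ^+ 2 *: riemann G (t *: z) v z z =
      - (2 * t) *: a t - t ^+ 2 *: a' t - t ^+ 2 *: Gamma G (t *: z) z (a t).
    rewrite riemannE// Gamma_ray// (GammaC v z Ut) -aE.
    have a'E : Gamma_der (t *: z) z v z = a' t.
      by rewrite (Gamma_derC z v z Ut) /a' add0r.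
    rewrite a'E Gamma0r addr0 !scalerBr; congr (_ - _ - _).
    by rewrite expr2 -scalerA dG0 scalerA; congr (_ *: _); ring.
  have : gdot G (t *: z) (t ^+ 2 *: riemann G (t *: z) v z z) v =
    - (2 * t) * gdot G (t *: z) (a t) v - t ^+ 2 * gdot G (t *: z) (a' t) v
    - t ^+ 2 * gdot G (t *: z) (a t) (a t).
    rewrite rE -(scaleNr (t ^+ 2) (a' t)) -(scaleNr (t ^+ 2) (Gamma _ _ _ _)).
    by rewrite !(gdotDl, gdotZl) Gav; ring.
  rewrite gdotZl /P' add0r Tav => h; rewrite mulrBr h; ring.
have P'K (t : R) : 0 < t < 1 -> `|P' t| <= t ^+ 2 * K.
  move=> /[dup] t01 /andP[t0 t1]; rewrite P'E// normrM ger0_norm ?sqr_ge0//.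
  rewrite ler_wpM2l ?sqr_ge0//.
  have t01' : 0 < t <= 1 by rewrite t0 ltW.
  have Dt : D (t *: z) by apply: ballZ; rewrite ?ltW.
  have zz : gdot G (t *: z) z z = edot z z by rewrite gdot_ray.
  have vv := gdot_le2 v Dt.
  have aa : gdot G (t *: z) (a t) (a t) <= 4 * C ^+ 2 * (edot z z * edot v v).
    apply: le_trans (gdot_le2 _ Dt) _.
    have : enorm (a t) <= C * (Defs.gnorm G (t *: z) z * Defs.gnorm G (t *: z) v).
      by rewrite /a add0r; exact: Gamma_bound.
    move/edot_le_sqr; rewrite !exprMn !(gnorm_sqr _ (ballU Dt)) zz => h.
    have : C ^+ 2 * (edot z z * gdot G (t *: z) v v) <= C ^+ 2 * (edot z z * (2 * edot v v)).
      by rewrite ler_wpM2l// ler_wpM2l// edot_ge0.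
    lra.
  have a0 : 0 <= gdot G (t *: z) (a t) (a t) by rewrite gdot_ge0//; exact: ballU.
  apply: le_trans (ler_normB _ _) _; rewrite (ger0_norm a0).
  have := curvature_bound v z Dt; rewrite zz => cb.
  have : C * (gdot G (t *: z) v v * edot z z) <= C * ((2 * edot v v) * edot z z).
    by rewrite ler_wpM2l ?(ltW C_gt0)// ler_wpM2r// edot_ge0.
  rewrite /K; lra.
have K0 : 0 <= K.
  by rewrite mulr_ge0// addr_ge0 ?mulr_ge0 ?(ltW C_gt0).
have gav (t : R) : 0 < t < 1 -> `|gdot G (t *: z) (a t) v| <= K.
  move=> /andP[t0 t1].
  have : `|P t - P 0| <= t ^+ 2 * K * t.
    apply: (mean_value_bound (f' := P')) => // s /andP[s0 st].
      by apply: dP; rewrite s0 (le_trans st)// ltW.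
    apply: le_trans (P'K s _) _; first by rewrite s0 (lt_trans st).
    by rewrite ler_wpM2r// lerXn2r ?nnegrE ?ltW.
  rewrite /P expr0n mul0r subr0 normrM ger0_norm ?sqr_ge0// -mulrA add0r.
  rewrite ler_pM2l ?exprn_gt0// => h; apply: le_trans h _.
  by rewrite ler_piMr// ltW.
pose f (t : R) := gdot G (0 + t *: z) v v.
have : `|f 1 - f 0| <= (2 * K) * 1.
  apply: (@mean_value_bound _ f (fun t => T (0 + t *: z) z v v) (2 * K) 1 ltr01).
    move=> t t01.
    have := is_derive_gdot (U01 t t01) (is_derive_entry_cst v t) (is_derive_entry_cst v t).
    by rewrite gdot0l gdot0r !addr0.
  move=> t /[dup] t01 /andP[t0 t1].
  have t01' : 0 < t <= 1 by rewrite t0 ltW.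
  have := gav t t01; rewrite /a add0r gdot_Gamma_ray// normrM gtr0_norm; last lra.
  lra.
rewrite /f add0r scale1r add0r scale0r mulr1.
have -> : gdot G 0 v v = edot v v.
  by rewrite /gdot metric0 mulmx1 mxE edot_row; apply: eq_bigr => j _; rewrite mxE.
move=> h; apply: le_trans h _; rewrite /K /metric_const; lra.
Qed.

End NormalCoordinates.
End Metric.

(** * Changes of charts, speeds and geodesics *)

Section Charts.
Context (R : realType) (q : nat) (M : riemannian_manifold R q).
Local Notation V := 'rV[R]_q.
Implicit Types (c : chart R q M) (gam : R -> M) (x p : M) (y : V).

Lemma chart_open c : atlas c -> open (cdom c) /\ open (ccod c).
Proof. by case/atlas_homeo. Qed.

Lemma cmapK c x : atlas c -> cdom c x -> cinv c (cmap c x) = x.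
Proof. by case/atlas_homeo => _ h _ _ _ /h[]. Qed.

Lemma cmap_cod c x : atlas c -> cdom c x -> ccod c (cmap c x).
Proof. by case/atlas_homeo => _ h _ _ _ /h[]. Qed.

Lemma cinvK c y : atlas c -> ccod c y -> cmap c (cinv c y) = y.
Proof. by case/atlas_homeo => _ _ h _ _ /h[]. Qed.

Lemma cinv_dom c y : atlas c -> ccod c y -> cdom c (cinv c y).
Proof. by case/atlas_homeo => _ _ h _ _ /h[]. Qed.

Lemma continuous_cmap c x : atlas c -> cdom c x -> {for x, continuous (cmap c)}.
Proof.
case/atlas_homeo => -[oc _] _ _ + _ cx.
by rewrite continuous_open_subspace//; apply; rewrite inE.
Qed.

Lemma continuous_cinv c y : atlas c -> ccod c y -> {for y, continuous (cinv c)}.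
Proof.
case/atlas_homeo => -[_ oc] _ _ _ + cx.
by rewrite continuous_open_subspace//; apply; rewrite inE.
Qed.

Lemma near_cdom c gam t : atlas c -> {for t, continuous gam} -> cdom c (gam t) ->
  \forall s \near t, cdom c (gam s).
Proof.
move=> ac cg ct; apply: (cg (cdom c)); apply: open_nbhs_nbhs; split => //.
by case: (chart_open ac).
Qed.

Lemma near_ccod c y : atlas c -> ccod c y -> \forall z \near y, ccod c z.
Proof. by move=> ac cy; apply: open_nbhs_nbhs; split => //; case: (chart_open ac). Qed.

Lemma near_overlap c c' y : atlas c -> atlas c' -> overlap c c' y ->
  \forall z \near y, overlap c c' z.
Proof.
move=> ac ac' [cy cy'].
have h : \forall z \near y, cdom c' (cinv c z).
  apply: (continuous_cinv ac cy); apply: open_nbhs_nbhs; split => //.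
  by case: (chart_open ac').
by apply: filterS2 (near_ccod ac cy) h => z ? ?; split.
Qed.

Lemma chart_change c c' gam t : atlas c -> atlas c' -> {for t, continuous gam} ->
  cdom c (gam t) ->
  \forall s \near t, transition c c' (in_chart c gam s) = in_chart c' gam s.
Proof.
move=> ac ac' cg ct; apply: filterS (near_cdom ac cg ct) => s cs.
by rewrite /transition /in_chart cmapK.
Qed.

Lemma in_chart_overlap c c' gam t : atlas c -> cdom c (gam t) -> cdom c' (gam t) ->
  overlap c c' (in_chart c gam t).
Proof. by move=> ac ct ct'; split; rewrite /in_chart ?cmapK//; exact: cmap_cod. Qed.

Lemma transition_differentiable c c' y : atlas c -> atlas c' -> overlap c c' y ->
  differentiable (transition c c') y.
Proof. by move=> ac ac' oy; have [/(_ [::] y oy)] := atlas_smooth ac ac'. Qed.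

(** The speed may be computed in any chart, since the metric is a tensor. *)
Lemma speedE c gam t : atlas c -> {for t, continuous gam} -> cdom c (gam t) ->
  (forall c', atlas c' -> cdom c' (gam t) -> derivable (in_chart c' gam) t 1) ->
  speed gam t = Defs.gnorm (metric c) (in_chart c gam t) (derive1 (in_chart c gam) t).
Proof.
move=> ac cg ct dgam; rewrite /speed.
have [] := atlas_cover (gam t); move: (chart_at (gam t)) => c0 ac0 c0t.
have ov := in_chart_overlap ac0 c0t ct.
have dT := transition_differentiable ac0 ac ov.
have h := is_derive_curve (dgam _ ac0 c0t) dT.
have {}h := near_eq_is_derive (chart_change ac0 ac cg c0t) h.
have -> : derive1 (in_chart c gam) t =
    derive1 (in_chart c0 gam) t *m 'J (transition c0 c) (in_chart c0 gam t).
  rewrite !derive1E; case: h => _ ->.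
  by rewrite -deriveE// deriveEjacobian.
rewrite /Defs.gnorm /gdot; congr (Num.sqrt _).
rewrite -[cmap c0 (gam t)]/(in_chart c0 gam t) (metric_tensor ac0 ac ov).
have -> : transition c0 c (in_chart c0 gam t) = in_chart c gam t.
  exact: (nbhs_singleton (chart_change ac0 ac cg c0t)).
by rewrite trmx_mul !mulmxA.
Qed.

Lemma geodesic_C1 gam t : geodesic_at gam t -> C1_at gam t.
Proof.
move=> [cg h]; split; first exact: cg.
move=> c ac ct; have [d1 d2 _] := h c ac ct; split; first exact: d1.
exact/differentiable_continuous/derivable1_diffP.
Qed.

(** Geodesics with initial velocity t v are rescaled geodesics with initial velocity
    v; this is what identifies the rays of a normal chart as geodesics. *)
Lemma geodesic_at_rescale gam a t : geodesic_at gam (a * t) ->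
  geodesic_at (fun s => gam (a * s)) t.
Proof.
move=> [cg h].
have cm : {for t, continuous (fun s : R => a * s)}.
  exact: mulrl_continuous.
split; first exact: (@continuous_comp _ _ _ (fun s : R => a * s) gam).
move=> c ac ct.
have [d1 d2 eqn] := h c ac ct.
pose u := in_chart c gam.
have d1' : \forall s \near t, is_derive s (1:R) (fun s => u (a * s)) (a *: derive1 u (a * s)).
  have : \forall s \near t, derivable u (a * s) 1 by exact: near_continuous cm d1.
  by apply: filterS => s /is_derive_rescale; rewrite derive1E.
have e1 : \forall s \near t, a *: derive1 u (a * s) = derive1 (fun s => u (a * s)) s.
  by apply: filterS d1' => s [_ <-]; rewrite derive1E.
have d2' := is_deriveZ a (is_derive_rescale d2).
have {}d2' := near_eq_is_derive e1 d2'.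
split.
- by apply: filterS d1' => s [].
- by case: d2'.
- rewrite [LHS]derive1E; case: d2' => _ ->.
  rewrite -derive1E eqn -(nbhs_singleton e1).
  rewrite -[in_chart c _ t]/(u (a * t)) GammaZl GammaZr !scalerN !scalerA//.
Qed.

(** In a normal chart the rays from 0 are geodesics.  They have no coordinate
    acceleration, so the geodesic equation forces the Christoffel symbols to
    vanish radially. *)
Lemma normal_chart_Gamma phi p rad : normal_chart phi p rad ->
  forall z : V, enorm z < rad -> Gamma (metric phi) z z z = 0.
Proof.
move=> [[aphi pphi] phip0 m0 cod isexp] z zr.
have [->|z0] := eqVneq z 0.
  by rewrite -(scale0r (0:V)) GammaZl !scale0r.
have ez0 : 0 < enorm z.
  by rewrite lt_neqAle enorm_ge0 andbT eq_sym -sqrf_eq0 edot_sqr edot_eq0.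
pose l := (enorm z + rad) / 2 / enorm z.
have l1 : 1 < l by rewrite ltr_pdivlMr// mul1r; lra.
have l0 : 0 < l by exact: lt_trans l1.
pose v := l *: z.
have vr : enorm v < rad.
  by rewrite /v enormZ gtr0_norm// /l divfK ?gt_eqF//; lra.
have [[gam [ggam gam0 gamv]] _] := isexp v vr.
have ray t : 0 < t <= 1 -> gam t = cinv phi (t *: v).
  move=> /andP[t0 t1].
  have tv : enorm (t *: v) < rad.
    rewrite enormZ gtr0_norm//; apply: le_lt_trans vr.
    by rewrite ler_piMl// enorm_ge0.
  have [_ uniq] := isexp (t *: v) tv.
  rewrite -(uniq (fun s => gam (t * s))) ?mulr1//; split.
  - move=> s /andP[s0 s1]; apply: geodesic_at_rescale; apply: ggam.
    by rewrite mulr_ge0 ?(ltW t0)// mulr_ile1// ltW.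
  - by rewrite mulr0.
  - have g0 : geodesic_at gam 0 by apply: ggam; rewrite lexx ler01.
    have [_ /(_ phi aphi)] := g0; rewrite gam0 => /(_ pphi)[d1 _ _].
    have d0 : derivable (in_chart phi gam) (t * 0) 1.
      by rewrite mulr0; exact: nbhs_singleton d1.
    have [_] := is_derive_rescale d0; rewrite -!derive1E mulr0 gamv => <-.
    by rewrite /in_chart.
have t01 : 0 < l^-1 < 1 by rewrite invr_gt0 l0 invf_lt1.
have /andP[t0 t1] := t01.
have near_ray : \forall s \near l^-1, s *: v = in_chart phi gam s.
  have : \forall s \near l^-1, s \in `]0, 1[%R by apply: near_in_itvoo; rewrite in_itv.
  apply: filterS => s; rewrite in_itv/= => /andP[s0 s1].
  rewrite /in_chart ray ?s0 ?ltW// cinvK//; apply: cod.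
  rewrite enormZ gtr0_norm//; apply: le_lt_trans vr.
  by rewrite ler_piMl ?enorm_ge0// ltW.
have lv : l^-1 *: v = z by rewrite /v scalerA mulVf ?gt_eqF// scale1r.
have gz : gam l^-1 = cinv phi z by rewrite ray ?t0 ?ltW// lv.
have [|_ /(_ phi aphi)] := ggam l^-1; first by rewrite !ltW.
rewrite gz => /(_ (cinv_dom aphi (cod z zr)))[d1 _].
have dl (s : R) : is_derive s (1:R) (fun s : R => s *: v) v.
  have := @is_derive_line _ _ _ id 0 v s; rewrite add0r => h.
  have [] : is_derive s (1:R) (fun s : R => id (0 + s *: v)) ('D_v id (s *: v)).
    by apply: h; rewrite ?add0r.
  rewrite derive_id => h1 h2.
  rewrite (_ : (fun s : R => s *: v) = (fun s : R => id (0 + s *: v))) //.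
  by apply/funext => ?; rewrite add0r.
have e1 : \forall s \near l^-1, v = derive1 (in_chart phi gam) s.
  apply: filterS (near_join near_ray) => s hs.
  by have [_ <-] := near_eq_is_derive hs (dl s); rewrite derive1E.
have e2 : derive1 (derive1 (in_chart phi gam)) l^-1 = 0.
  by rewrite derive1E -(near_eq_derive _ e1) derive_cst.
rewrite -(nbhs_singleton e1) -(nbhs_singleton near_ray) lv e2 => /esym/eqP.
rewrite oppr_eq0 GammaZl GammaZr scalerA scaler_eq0 mulf_eq0 (gt_eqF l0)/=.
by move/eqP.
Qed.

End Charts.

(** * Geodesic distance in a normal ball *)

Section Monotone.
Local Open Scope ereal_scope.
Context d (T : measurableType d) (R : realType) (mu : {measure set T -> \bar R}).

(** The integral of any nonnegative function is the supremum over the simple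
    functions below it, hence monotone.  Speeds of curves and geodesic distances
    can thus be estimated without first being shown measurable. *)
Lemma le_integral_ge0 (D : set T) (f g : T -> \bar R) :
  (forall x, D x -> 0 <= f x) -> (forall x, D x -> f x <= g x) ->
  \int[mu]_(x in D) f x <= \int[mu]_(x in D) g x.
Proof.
move=> f0 fg.
have g0 x : D x -> 0 <= g x by move=> Dx; apply: le_trans (f0 x Dx) (fg x Dx).
rewrite !ge0_integralE//; apply: ereal_sup_le => _ [h hf <-]; exists h => // x.
by apply: le_trans (hf x) _; apply: lee_restrict.
Qed.

Lemma le_integral_ge0r (D : set T) (f g : T -> \bar R) :
  (forall x, D x -> 0 <= g x) -> (forall x, D x -> f x <= g x) ->
  \int[mu]_(x in D) f x <= \int[mu]_(x in D) g x.
Proof.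
move=> g0 fg; rewrite integralE.
have n0 : 0 <= \int[mu]_(x in D) f^\- x by apply: integral_ge0 => x _; exact: funeneg_ge0.
apply: (@le_trans _ _ (\int[mu]_(x in D) f^\+ x)).
  rewrite -[leRHS]sube0 leeB//.
apply: le_integral_ge0 => x Dx; first exact: funepos_ge0.
by rewrite funeposE ge_max fg//= g0.
Qed.

End Monotone.

Section CurveIntegral.
Context (R : realType) (q : nat).
Local Notation V := 'rV[R]_q.
Local Notation leb := (@lebesgue_measure R).

Lemma integral_derive1_edot (u : R -> V) (e : V) :
  (forall t : R, 0 <= t <= 1 ->
    (\forall s \near t, derivable u s 1) /\ {for t, continuous (derive1 u)}) ->
  (\int[leb]_(t in `[0%R, 1%R]) (edot (derive1 u t) e)%:E
    = (edot (u 1 - u 0) e)%:E)%E.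
Proof.
move=> hu.
pose F (t : R) := edot (u t) e.
have dF (t : R) : derivable u t 1 -> is_derive t (1:R) F (edot (derive1 u t) e).
  move=> du.
  have du' j : is_derive t (1:R) (fun s => u s 0 j) (derive1 u t 0 j).
    apply: DeriveDef; first exact: (derivable_mxP u t 1).1.
    by rewrite derive1E derive_mx// mxE.
  have := is_derive_edot du' (is_derive_entry_cst e t).
  by rewrite (edotC _ 0) edot0l addr0.
have cF (t : R) : 0 <= t <= 1 -> {for t, continuous F}.
  move=> /hu[/nbhs_singleton/dF[dFt _] _].
  exact/differentiable_continuous/derivable1_diffP.
rewrite (@continuous_FTC2 _ _ F)//.
- by rewrite -EFinB /F edotDl edotNl.
- apply/continuous_in_subspaceT => t; rewrite inE/= in_itv/= => /hu[_ cu].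
  apply: (@continuous_comp _ _ _ (derive1 u) (fun v : V => edot v e)) => //.
  apply: differentiable_continuous; rewrite /edot.
  apply: differentiable_bigsum => i; apply: differentiable_bigsum => j.
  apply: (@differentiableM _ _ (fun v : V => v i j) (cst (e i j))) => //.
  exact: differentiable_coord.
- split.
  + move=> t; rewrite in_itv/= => /andP[/ltW t0 /ltW t1].
    by have [/nbhs_singleton/dF[]] : _ /\ _ := hu t (introT andP (conj t0 t1)).
  + by apply: cvg_at_right_filter; apply: cF; rewrite lexx ler01.
  + by apply: cvg_at_left_filter; apply: cF; rewrite lexx ler01.
- move=> t; rewrite in_itv/= => /andP[/ltW t0 /ltW t1].
  have [/nbhs_singleton/dF[_ h] _] := hu t (introT andP (conj t0 t1)).
  by rewrite derive1E h.
Qed.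

End CurveIntegral.

Section Distance.
Context (R : realType) (q : nat) (M : riemannian_manifold R q).
Local Notation V := 'rV[R]_q.
Variables (phi : chart R q M) (p : M) (rad k : R).
Hypothesis normal : normal_chart phi p rad.
Hypothesis convex : strongly_convex (coord_ball phi rad).
Hypothesis k_ge0 : 0 <= k.
Hypothesis metric_close : forall z v : V, enorm z < rad ->
  `|gdot (metric phi) z v v - edot v v| <= k * edot v v.

Let aphi : atlas phi. Proof. by case: normal => -[]. Qed.
Let cod (v : V) : enorm v < rad -> ccod phi v. Proof. by case: normal => _ _ _ h _ /h. Qed.

Lemma gnorm_le z (v : V) : enorm z < rad ->
  Defs.gnorm (metric phi) z v <= Num.sqrt (1 + k) * enorm v.
Proof.
move=> zr; rewrite /enorm -sqrtrM ?addr_ge0// ler_wsqrtr// mulrDl mul1r addrC.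
by have := metric_close v zr; rewrite ler_norml => /andP[_]; rewrite lerBlDr.
Qed.

Lemma gnorm_ge z (v : V) : enorm z < rad ->
  Num.sqrt (1 - k) * enorm v <= Defs.gnorm (metric phi) z v.
Proof.
move=> zr; have [k1|k1] := leP (1 - k) 0.
  by rewrite ler0_sqrtr// mul0r sqrtr_ge0.
rewrite /enorm -sqrtrM ?(ltW k1)// ler_wsqrtr// mulrBl mul1r.
by have := metric_close v zr; rewrite ler_norml => /andP[+ _]; rewrite lerBrDl; lra.
Qed.

Let ball_segment (a b : V) (t : R) : enorm a < rad -> enorm b < rad -> 0 <= t <= 1 ->
  enorm (a + t *: (b - a)) < rad.
Proof.
move=> ar br /andP[t0 t1].
have -> : a + t *: (b - a) = (1 - t) *: a + t *: b.
  by apply/matrixP => i j; rewrite !mxE; ring.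
apply: le_lt_trans (enormD _ _) _; rewrite !enormZ !ger0_norm ?subr_ge0//.
have [->|tn] := eqVneq t 0; first by rewrite subr0 mul1r mul0r addr0.
have tp : 0 < t by rewrite lt_neqAle eq_sym tn.
have : (1 - t) * enorm a <= (1 - t) * rad by rewrite ler_wpM2l ?subr_ge0// ltW.
have : t * enorm b < t * rad by rewrite ltr_pM2l.
lra.
Qed.

(** The coordinate segment stays in the ball and competes in the infimum. *)
Lemma rho_le x y : coord_ball phi rad x -> coord_ball phi rad y ->
  (rho x y <= (Num.sqrt (1 + k) * enorm (cmap phi y - cmap phi x))%:E)%E.
Proof.
move=> [xd xr] [yd yr].
set a := cmap phi x; set b := cmap phi y.
pose l (t : R) : V := a + t *: (b - a).
have lr (t : R) : 0 <= t <= 1 -> enorm (l t) < rad by exact: ball_segment.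
pose gam (t : R) : M := cinv phi (l t).
have cl (t : R) : {for t, continuous l}.
  apply: continuousD; first exact: cst_continuous.
  exact: scalel_continuous.
have cg (t : R) : 0 <= t <= 1 -> {for t, continuous gam}.
  move=> t01; apply: (@continuous_comp _ _ _ l (cinv phi)); first exact: cl.
  exact/continuous_cinv/cod/lr.
have gd (t : R) : 0 <= t <= 1 -> cdom phi (gam t).
  by move=> t01; apply: cinv_dom => //; exact/cod/lr.
have in_gam c : in_chart c gam = (fun t => transition phi c (l t)) by [].
have ov c (t : R) : 0 <= t <= 1 -> cdom c (gam t) -> overlap phi c (l t).
  by move=> t01 ct; split => //; exact/cod/lr.
have dgam c (t : R) : atlas c -> overlap phi c (l t) ->
    is_derive t (1:R) (in_chart c gam) ('D_(b - a) (transition phi c) (l t)).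
  move=> ac o; rewrite in_gam; apply: is_derive_line.
  exact: transition_differentiable.
have nearov c (t : R) : atlas c -> 0 <= t <= 1 -> cdom c (gam t) ->
    \forall s \near t, overlap phi c (l s).
  by move=> ac t01 ct; apply: (cl t); apply: near_overlap => //; exact: ov.
have C1 : C1_curve gam.
  move=> t t01; split; first exact: cg.
  move=> c ac ct; have no := nearov c t ac t01 ct; split.
    by apply: filterS no => s /(dgam c s ac)[].
  apply: (@near_eq_continuous _ _
      (fun s => \sum_i (b - a) 0 i *: pderiv i (transition phi c) (l s))).
    apply: filterS no => s os; rewrite derive1E; have [_ ->] := dgam c s ac os.
    rewrite deriveE; last exact: transition_differentiable.
    rewrite {2}(row_sum_delta (b - a)) linear_sum; apply: eq_bigr => i _.
    by rewrite linearZ -deriveE//; exact: transition_differentiable.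
  have ot := ov c t t01 ct.
  rewrite -fct_sumE; elim/big_ind : _ => [|f g cf cg'|i _].
  - exact: cst_continuous.
  - exact: continuousD.
  - apply: continuousZr.
    apply: (@continuous_comp _ _ _ l (pderiv i (transition phi c))); first exact: cl.
    apply: differentiable_continuous.
    by have [/(_ [:: i] _ ot)] := atlas_smooth aphi ac.
have gam0 : gam 0 = x by rewrite /gam /l scale0r addr0 cmapK.
have gam1 : gam 1 = y by rewrite /gam /l scale1r addrC subrK cmapK.
apply: (@le_trans _ _ (curve_length gam)).
  by apply: ereal_inf_lbound; exists gam.
apply: (@le_trans _ _ (\int[@lebesgue_measure R]_(t in `[0%R, 1%R])
     (cst (Num.sqrt (1 + k) * enorm (b - a))%:E t))%E).
  apply: le_integral_ge0 => t; rewrite /= in_itv/= => t01; rewrite lee_fin.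
    exact: sqrtr_ge0.
  rewrite (@speedE _ _ _ phi)//; [|exact: cg|exact: gd|]; last first.
    by move=> c ac ct; have [] := dgam c t ac (ov c t t01 ct).
  have -> : derive1 (in_chart phi gam) t = b - a.
    have e1 : \forall s \near t, l s = in_chart phi gam s.
      apply: filterS (nearov phi t aphi t01 (gd t t01)) => s [cs _].
      by rewrite /in_chart cinvK.
    rewrite derive1E -(near_eq_derive _ e1).
    have [_ ->] : is_derive t (1:R) l ('D_(b - a) id (l t)).
      by apply: (@is_derive_line _ _ _ id).
    by rewrite derive_id.
  by rewrite /in_chart cinvK ?gnorm_le//; [exact: lr|exact/cod/lr].
rewrite integral_cst//= lebesgue_measure_itv/= lte_fin ltr01 -EFinB subr0 mule1.
exact: lexx.
Qed.

(** By convexity the distance is attained by a curve inside the ball, where the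
    Riemannian length dominates the Euclidean one up to the factor. *)
Lemma rho_ge x y : coord_ball phi rad x -> coord_ball phi rad y ->
  ((Num.sqrt (1 - k) * enorm (cmap phi y - cmap phi x))%:E <= rho x y)%E.
Proof.
move=> Bx By.
have [gam [[ggam gam0 gam1 <-] gamB] _] := convex Bx By.
set e := cmap phi y - cmap phi x.
have c1 (t : R) : 0 <= t <= 1 -> C1_at gam t by move=> t01; exact/geodesic_C1/ggam.
pose u := in_chart phi gam.
have hu (t : R) : 0 <= t <= 1 ->
    (\forall s \near t, derivable u s 1) /\ {for t, continuous (derive1 u)}.
  move=> t01; have [_ /(_ phi aphi)] := c1 t t01; apply.
  by have [] := gamB t t01.
have [e0|e0] := eqVneq (enorm e) 0.
  rewrite e0 mulr0; apply: integral_ge0 => t _; rewrite lee_fin; exact: sqrtr_ge0.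
have ep : 0 < enorm e by rewrite lt_neqAle eq_sym e0 enorm_ge0.
pose e' := (Num.sqrt (1 - k) / enorm e) *: e.
have -> : (Num.sqrt (1 - k) * enorm e)%:E = (edot (u 1 - u 0) e')%:E.
  rewrite /u /in_chart gam0 gam1 -/e edotZr -edot_sqr; congr EFin; field.
  by rewrite gt_eqF.
rewrite -integral_derive1_edot//; apply: le_integral_ge0r => t; rewrite /= in_itv/= => t01.
  by rewrite lee_fin; exact: sqrtr_ge0.
have [ct cat] := c1 t t01; have [td tr] := gamB t t01.
rewrite lee_fin (@speedE _ _ _ phi)//; last first.
  by move=> c ac /(cat c ac)[/nbhs_singleton].
apply: le_trans (gnorm_ge _ _) => //.
apply: le_trans (ler_norm _) _; rewrite edotZr normrM.
rewrite ger0_norm; last by rewrite divr_ge0 ?sqrtr_ge0 ?enorm_ge0.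
rewrite -mulrA ler_wpM2l ?sqrtr_ge0// mulrC ler_pdivrMr//.
exact: edot_le.
Qed.

Lemma rho_chart x y : coord_ball phi rad x -> coord_ball phi rad y ->
  exists2 D : R, rho x y = D%:E &
    let E := edot (cmap phi y - cmap phi x) (cmap phi y - cmap phi x) in
    (1 - k) * E <= D ^+ 2 <= (1 + k) * E.
Proof.
move=> Bx By; have := rho_ge Bx By; have := rho_le Bx By.
set e := cmap phi y - _.
case: (rho x y) => [D| |]; rewrite ?lee_fin// => D1 D2.
exists D => //=; have D0 : 0 <= D.
  by apply: le_trans D2; rewrite mulr_ge0 ?sqrtr_ge0 ?enorm_ge0.
apply/andP; split.
  have [k1|k1] := leP (1 - k) 0.
    by apply: (@le_trans _ _ 0); rewrite ?sqr_ge0// mulr_le0_ge0// edot_ge0.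
  rewrite -edot_sqr -(sqr_sqrtr (ltW k1)) -exprMn lerXn2r// ?nnegrE//.
  by rewrite mulr_ge0 ?sqrtr_ge0 ?enorm_ge0.
have k1 : 0 <= 1 + k by rewrite addr_ge0.
rewrite -edot_sqr -(sqr_sqrtr k1) -exprMn lerXn2r// ?nnegrE//.
by rewrite mulr_ge0 ?sqrtr_ge0 ?enorm_ge0.
Qed.

End Distance.

(** * Integrals of bounded measurable functions *)

Lemma discriminant_le0 (R : realFieldType) (a b c : R) : 0 <= c ->
  (forall l : R, 0 <= a - 2 * l * b + l ^+ 2 * c) -> b ^+ 2 <= a * c.
Proof.
rewrite le_eqVlt => /predU1P[<-|c0] h.
  rewrite mulr0; have [->|b0] := eqVneq b 0; first by rewrite expr0n.
  have := h ((a + 1) / (2 * b)); rewrite mulr0 addr0.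
  have -> : 2 * ((a + 1) / (2 * b)) * b = a + 1 by field.
  by rewrite opprD addrA subrr sub0r oppr_ge0 lt_geF.
have := h (b / c).
have -> : a - 2 * (b / c) * b + (b / c) ^+ 2 * c = (a * c - b ^+ 2) / c.
  by field; rewrite gt_eqF.
by rewrite pmulr_lge0 ?invr_gt0// subr_ge0.
Qed.

Section BoundedMeasurable.
Context d (T : measurableType d) (R : realType) (mu : {measure set T -> \bar R}).
Variables (D : set T) (mD : measurable D) (muD : (mu D < +oo)%E).

(** This class is closed under sums and products and the integral is linear on it,
    which keeps integrability conditions out of the moment computations. *)
Definition bounded_mfun (f : T -> R) : Prop :=
  measurable_fun D f /\ exists b : R, forall x, D x -> `|f x| <= b.

Local Notation "'I' f" := (Rintegral mu D f) (at level 10, f at level 9).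

Lemma bm_integrable f : bounded_mfun f -> mu.-integrable D (EFin \o f).
Proof.
move=> [mf [b fb]]; apply: measurable_bounded_integrable => //.
by exists b; split; rewrite ?num_real// => x bx y Dy /=; apply: le_trans (fb y Dy) (ltW bx).
Qed.

Lemma bm_cst a : bounded_mfun (fun=> a).
Proof. by split; [exact: measurable_cst|exists `|a|]. Qed.

Lemma bmD f g : bounded_mfun f -> bounded_mfun g -> bounded_mfun (fun x => f x + g x).
Proof.
move=> [mf [b fb]] [mg [c gc]]; split; first exact: measurable_funD.
exists (b + c) => x Dx; apply: le_trans (ler_normD _ _) _.
by rewrite lerD ?fb ?gc.
Qed.

Lemma bmM f g : bounded_mfun f -> bounded_mfun g -> bounded_mfun (fun x => f x * g x).
Proof.
move=> [mf [b fb]] [mg [c gc]]; split; first exact: measurable_funM.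
by exists (b * c) => x Dx; rewrite normrM ler_pM ?fb ?gc.
Qed.

Lemma bmZ a f : bounded_mfun f -> bounded_mfun (fun x => a * f x).
Proof. exact/bmM/bm_cst. Qed.

Lemma bmN f : bounded_mfun f -> bounded_mfun (fun x => - f x).
Proof. by move=> /(bmZ (-1)); under eq_fun do rewrite mulN1r. Qed.

Lemma bmB f g : bounded_mfun f -> bounded_mfun g -> bounded_mfun (fun x => f x - g x).
Proof. by move=> bf /bmN; exact: bmD. Qed.

Lemma bm_norm f : bounded_mfun f -> bounded_mfun (fun x => `|f x|).
Proof.
move=> [mf [b fb]]; split; first exact: measurableT_comp.
by exists b => x Dx; rewrite normr_id fb.
Qed.

Lemma bm_sum (J : Type) (s : seq J) (Q : pred J) (f : J -> T -> R) :
  (forall j, bounded_mfun (f j)) -> bounded_mfun (fun x => \sum_(j <- s | Q j) f j x).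
Proof.
move=> bf; elim: s => [|j s ih].
  by under eq_fun do rewrite big_nil; exact: bm_cst.
by under eq_fun do rewrite big_cons; case: (Q j) => //; exact: bmD.
Qed.

Lemma eq_bm f g : (forall x, D x -> f x = g x) -> bounded_mfun f -> bounded_mfun g.
Proof.
move=> fg [mf [b fb]]; split; last by exists b => x Dx; rewrite -fg// fb.
by apply: eq_measurable_fun mf => x; rewrite inE => /fg.
Qed.

Lemma int_eq f g : (forall x, D x -> f x = g x) -> I f = I g.
Proof. by move=> fg; apply: eq_Rintegral => x; rewrite inE => /fg. Qed.

Lemma intD f g : bounded_mfun f -> bounded_mfun g -> I (fun x => f x + g x) = I f + I g.
Proof. by move=> bf bg; rewrite RintegralD//; exact: bm_integrable. Qed.

Lemma intZ a f : bounded_mfun f -> I (fun x => a * f x) = a * I f.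
Proof. by move=> bf; rewrite RintegralZl//; exact: bm_integrable. Qed.

Lemma intB f g : bounded_mfun f -> bounded_mfun g -> I (fun x => f x - g x) = I f - I g.
Proof. by move=> bf bg; rewrite RintegralB//; exact: bm_integrable. Qed.

Lemma int_cst a : I (fun=> a) = a * fine (mu D).
Proof. exact: Rintegral_cst. Qed.

Lemma int_le f g : bounded_mfun f -> bounded_mfun g ->
  (forall x, D x -> f x <= g x) -> I f <= I g.
Proof. by move=> bf bg; apply: le_Rintegral => //; exact: bm_integrable. Qed.

Lemma int_ge0 f : (forall x, D x -> 0 <= f x) -> 0 <= I f.
Proof. exact: Rintegral_ge0. Qed.

Lemma int_sum (J : Type) (s : seq J) (f : J -> T -> R) : (forall j, bounded_mfun (f j)) ->
  I (fun x => \sum_(j <- s) f j x) = \sum_(j <- s) I (f j).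
Proof.
move=> bf; elim: s => [|j s ih].
  by rewrite big_nil; under int_eq do rewrite big_nil; rewrite int_cst mul0r.
rewrite big_cons -ih -intD//; last exact: bm_sum.
by apply: int_eq => x _; rewrite big_cons.
Qed.

Lemma le_norm_int f : bounded_mfun f -> `|I f| <= I (fun x => `|f x|).
Proof. by move=> bf; apply: le_normr_Rintegral => //; exact: bm_integrable. Qed.

Lemma EFin_int f : bounded_mfun f -> (I f)%:E = (\int[mu]_(x in D) (f x)%:E)%E.
Proof.
by move=> bf; rewrite fineK//; apply: integrable_fin_num => //; exact: bm_integrable.
Qed.

Lemma int_cauchy_schwarz f g : bounded_mfun f -> bounded_mfun g ->
  (I (fun x => f x * g x)) ^+ 2 <= I (fun x => f x ^+ 2) * I (fun x => g x ^+ 2).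
Proof.
move=> bf bg; apply: discriminant_le0 => [|l].
  by apply: int_ge0 => x _; exact: sqr_ge0.
have : 0 <= I (fun x => (f x - l * g x) ^+ 2) by apply: int_ge0 => x _; exact: sqr_ge0.
have -> : I (fun x => (f x - l * g x) ^+ 2)
    = I (fun x => f x ^+ 2 - 2 * l * (f x * g x) + l ^+ 2 * g x ^+ 2).
  by apply: int_eq => x _; ring.
have b2 h : bounded_mfun h -> bounded_mfun (fun x => h x ^+ 2) by move=> bh; exact: bmM.
by rewrite intD ?intB ?intZ//; do ?[exact: bmB|exact: bmZ|exact: bmM|exact: b2 |
  apply: bmZ|apply: bmB|apply: b2].
Qed.

Lemma int_le_ae f b : bounded_mfun f -> (forall x, D x -> 0 <= f x) -> 0 <= b ->
  {ae mu, forall x, D x -> f x <= b} -> I f <= b * fine (mu D).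
Proof.
move=> bf f0 b0 fb.
rewrite -int_cst -lee_fin (EFin_int bf) (EFin_int (bm_cst b)).
have mf : measurable_fun D (EFin \o f) by apply/measurable_EFinP; case: bf.
by apply: ae_ge0_le_integral => // x _; rewrite lee_fin.
Qed.

Section Rows.
Context (q : nat).
Implicit Types X Y : T -> 'rV[R]_q.

Definition bounded_mrow X : Prop := forall j, bounded_mfun (fun x => X x 0 j).

Definition int_row X : 'rV[R]_q := \row_j I (fun x => X x 0 j).

Lemma bmrow_cst (v : 'rV[R]_q) : bounded_mrow (fun=> v).
Proof. by move=> j; exact: bm_cst. Qed.

Lemma bmrowB X Y : bounded_mrow X -> bounded_mrow Y -> bounded_mrow (fun x => X x - Y x).
Proof. by move=> bX bY j; under eq_fun do rewrite !mxE; exact: bmB. Qed.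

Lemma bm_edot X Y : bounded_mrow X -> bounded_mrow Y ->
  bounded_mfun (fun x => edot (X x) (Y x)).
Proof.
by move=> bX bY; under eq_fun do rewrite edot_row; apply: bm_sum => j; exact: bmM.
Qed.

Lemma int_edot_cst (v : 'rV[R]_q) X : bounded_mrow X ->
  I (fun x => edot v (X x)) = edot v (int_row X).
Proof.
move=> bX; rewrite edot_row.
under int_eq do rewrite edot_row.
rewrite int_sum; last by move=> j; exact: bmZ.
by apply: eq_bigr => j _; rewrite intZ// mxE.
Qed.

Lemma edot_cauchy_schwarz X Y : bounded_mrow X -> bounded_mrow Y ->
  (I (fun x => edot (X x) (Y x))) ^+ 2
    <= I (fun x => edot (X x) (X x)) * I (fun x => edot (Y x) (Y x)).
Proof.
move=> bX bY; apply: discriminant_le0 => [|l].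
  by apply: int_ge0 => x _; exact: edot_ge0.
have : 0 <= I (fun x => edot (X x - l *: Y x) (X x - l *: Y x)).
  by apply: int_ge0 => x _; exact: edot_ge0.
have -> : I (fun x => edot (X x - l *: Y x) (X x - l *: Y x))
    = I (fun x => edot (X x) (X x) - 2 * l * edot (X x) (Y x) + l ^+ 2 * edot (Y x) (Y x)).
  apply: int_eq => x _.
  by rewrite !(edotDl, edotDr, edotNl, edotNr, edotZl, edotZr) (edotC (Y x)); ring.
by rewrite intD ?intB ?intZ//; do ?[exact: bm_edot|apply: bmZ|apply: bmB].
Qed.

End Rows.

Lemma bmrow_mul n q (X : T -> 'rV[R]_n) (O : 'M[R]_(n, q)) :
  bounded_mrow X -> bounded_mrow (fun x => X x *m O).
Proof.
move=> bX j; under eq_fun do rewrite mxE; apply: bm_sum => i.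
by under eq_fun do rewrite mulrC; exact: bmZ.
Qed.

Lemma int_row_mul n q (X : T -> 'rV[R]_n) (O : 'M[R]_(n, q)) :
  bounded_mrow X -> int_row (fun x => X x *m O) = int_row X *m O.
Proof.
move=> bX; apply/rowP => j; rewrite !mxE.
under int_eq do rewrite mxE.
rewrite int_sum; last by move=> i; under eq_fun do rewrite mulrC; exact: bmZ.
apply: eq_bigr => i _; rewrite mxE mulrC -intZ//.
by apply: int_eq => x _; rewrite mulrC.
Qed.

Lemma int_rowD q (X Y : T -> 'rV[R]_q) : bounded_mrow X -> bounded_mrow Y ->
  int_row (fun x => X x + Y x) = int_row X + int_row Y.
Proof.
move=> bX bY; apply/rowP => j; rewrite !mxE -intD//.
by apply: int_eq => x _; rewrite mxE.
Qed.

Lemma int_close (f : T -> \bar R) (h e : T -> R) :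
  measurable_fun D f -> bounded_mfun h -> bounded_mfun e ->
  (forall x, D x -> exists2 y : R, f x = y%:E & `|y - h x| <= e x) ->
  (`| \int[mu]_(x in D) f x - (I h)%:E | <= (I e)%:E)%E.
Proof.
move=> mf bh be fhe.
have fE x : D x -> f x = (fine (f x))%:E by move=> /fhe[y ->].
have fh x : D x -> `|fine (f x) - h x| <= e x by move=> /fhe[y ->].
have bf : bounded_mfun (fine \o f).
  split; first exact: (measurableT_comp (fine_measurable measurableT) mf).
  have [_ [b hb]] := bh; have [_ [c ec]] := be; exists (b + c) => x Dx /=.
  rewrite -(subrK (h x) (fine (f x))) addrC; apply: le_trans (ler_normD _ _) _.
  rewrite lerD ?hb//; apply: le_trans (fh x Dx) _.
  exact: le_trans (ler_norm _) (ec x Dx).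
have -> : (\int[mu]_(x in D) f x)%E = (I (fine \o f))%:E.
  by rewrite EFin_int//; apply: eq_integral => x; rewrite inE => /fE.
rewrite -EFinB abse_EFin lee_fin -intB//; apply: le_trans (le_norm_int _) _.
  exact: bmB.
by apply: int_le => //; exact/bm_norm/bmB.
Qed.

End BoundedMeasurable.

(** * Moments of a linear image of the noise plus a remainder *)

Section Moments.
Context d (T : measurableType d) (R : realType) (P : probability T R).
Context (n q : nat).
Variables (Y : T -> 'rV[R]_n) (L : 'M[R]_(n, q)) (g : T -> 'rV[R]_q).
Hypothesis bY : bounded_mrow setT Y.
Hypothesis bg : bounded_mrow setT g.

Local Notation E f := (Rintegral P setT f).

Let mT : measurable [set: T] := measurableT.
Let PT : (P [set: T] < +oo)%E.
Proof. by rewrite probability_setT ltry. Qed.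
Let PT1 : fine (P [set: T]) = 1. Proof. by rewrite probability_setT. Qed.

Definition centered (w : T) : 'rV[R]_n := Y w - int_row P setT Y.

Definition second_moments : 'M[R]_n :=
  \matrix_(i, j) E (fun w => centered w 0 i * centered w 0 j).

Let zO (w : T) := centered w *m L.
Let W (w : T) := Y w *m L + g w.

Let b_centered : bounded_mrow setT centered.
Proof. by apply: bmrowB => //; exact: bmrow_cst. Qed.

Let b_zO : bounded_mrow setT zO. Proof. exact: bmrow_mul. Qed.

Let E_cst a : E (fun=> a) = a. Proof. by rewrite (int_cst P mT) PT1 mulr1. Qed.

Let int_row_cst m (v : 'rV[R]_m) : int_row P setT (fun=> v) = v.
Proof. by apply/rowP => j; rewrite mxE E_cst. Qed.

Let int_row_centered : int_row P setT centered = 0.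
Proof.
rewrite /centered; have -> : int_row P setT (fun w => Y w - int_row P setT Y)
    = int_row P setT Y + int_row P setT (fun=> - int_row P setT Y).
  by rewrite -int_rowD//; exact: bmrow_cst.
by rewrite int_row_cst subrr.
Qed.

Let int_row_zO : int_row P setT zO = 0.
Proof. by rewrite int_row_mul// int_row_centered mul0mx. Qed.

Lemma trace_second_moments :
  \tr (L^T *m second_moments *m L) = E (fun w => edot (zO w) (zO w)).
Proof.
have bz i j : bounded_mfun setT (fun w => centered w 0 i * centered w 0 j) by exact: bmM.
transitivity (\sum_k \sum_i \sum_j L i k * L j k * second_moments i j).
  rewrite /mxtrace; apply: eq_bigr => k _; rewrite !mxE.
  under eq_bigr do rewrite mxE mulr_suml.
  rewrite exchange_big; apply: eq_bigr => i _; apply: eq_bigr => j _.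
  rewrite [L^T _ _]mxE; ring.
under [RHS]int_eq do rewrite edot_row.
rewrite int_sum//; last by move=> k; exact: bmM.
apply: eq_bigr => k _.
transitivity (E (fun w => \sum_i \sum_j L i k * L j k * (centered w 0 i * centered w 0 j))).
  rewrite int_sum//; last by move=> i; apply: bm_sum => j; exact: bmZ.
  apply: eq_bigr => i _; rewrite int_sum//; last by move=> j; exact: bmZ.
  by apply: eq_bigr => j _; rewrite intZ// mxE.
apply: int_eq => w _; rewrite !mxE mulr_suml; apply: eq_bigr => i _.
by rewrite mulr_sumr; apply: eq_bigr => j _; ring.
Qed.

(** The part of the second moment of W = Y L + g about a point that is independent
    of the point, i.e. the variance of W.  Its first summand is the variance of
    the linear part Y L, and the others vanish with g. *)
Definition output_variance : R :=
  \tr (L^T *m second_moments *m L)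
  + (E (fun w => edot (g w) (g w)) - edot (int_row P setT g) (int_row P setT g))
  + 2 * E (fun w => edot (zO w) (g w)).

Lemma output_mean : int_row P setT W = int_row P setT Y *m L + int_row P setT g.
Proof. by rewrite int_rowD ?int_row_mul//; exact: bmrow_mul. Qed.

(** Bias and variance: all products of a constant with a centered vector average
    out.  In particular W has the smallest second moment about its mean. *)
Lemma second_moment_about b :
  E (fun w => edot (W w - b) (W w - b))
    = edot (int_row P setT W - b) (int_row P setT W - b) + output_variance.
Proof.
set c := int_row P setT W - b; set Eg := int_row P setT g.
have WE w : W w - b = c - Eg + (zO w + g w).
  rewrite /W /c output_mean /zO /centered mulmxBl.
  by apply/rowP => j; rewrite !mxE; ring.
have -> : E (fun w => edot (W w - b) (W w - b)) = E (fun w =>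
    edot (c - Eg) (c - Eg) + 2 * edot (c - Eg) (zO w) + 2 * edot (c - Eg) (g w)
    + edot (zO w) (zO w) + edot (g w) (g w) + 2 * edot (zO w) (g w)).
  apply: int_eq => w _; rewrite WE; move: (c - Eg) (zO w) => a z.
  by rewrite !(edotDl, edotDr) (edotC z a) (edotC (g w) a) (edotC (g w) z); ring.
have bc (v : 'rV[R]_q) (X : T -> 'rV[R]_q) :
    bounded_mrow setT X -> bounded_mfun setT (fun w => edot v (X w)).
  by move=> bX; apply: bm_edot => //; exact: bmrow_cst.
have b1 := bm_cst [set: T] (edot (c - Eg) (c - Eg)).
have b2 := bmZ 2 (bc (c - Eg) _ b_zO).
have b3 := bmZ 2 (bc (c - Eg) _ bg).
have b4 := bm_edot b_zO b_zO.
have b5 := bm_edot bg bg.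
have b6 := bmZ 2 (bm_edot b_zO bg).
have b12 := bmD b1 b2; have b13 := bmD b12 b3; have b14 := bmD b13 b4; have b15 := bmD b14 b5.
rewrite !intD// E_cst !intZ//; [|exact: bm_edot|exact: bc|exact: bc].
rewrite !int_edot_cst// int_row_zO -/Eg /output_variance trace_second_moments -/Eg.
have sq (u v : 'rV[R]_q) : edot (u - v) (u - v) = edot u u - 2 * edot u v + edot v v.
  by rewrite !(edotDl, edotDr, edotNl, edotNr) (edotC v u); ring.
have sc (u v : 'rV[R]_q) : edot (u - v) v = edot u v - edot v v by rewrite edotDl edotNl.
rewrite (edotC _ 0) edot0l sq sc; ring.
Qed.

Lemma trace_second_moments_ge0 : 0 <= \tr (L^T *m second_moments *m L).
Proof. by rewrite trace_second_moments; apply: int_ge0 => w _; exact: edot_ge0. Qed.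

Lemma edot_mean_le X : bounded_mrow setT X ->
  edot (int_row P setT X : 'rV[R]_q) (int_row P setT X) <= E (fun w => edot (X w) (X w)).
Proof.
move=> bX; set m := int_row P setT X.
have bm' := bmrow_cst [set: T] m.
have := edot_cauchy_schwarz mT PT bm' bX.
rewrite int_edot_cst// -/m E_cst expr2.
have [->|m0] := eqVneq (edot m m) 0; first by move=> _; apply: int_ge0 => w _; exact: edot_ge0.
by rewrite ler_pM2l// lt_neqAle eq_sym m0 edot_ge0.
Qed.

(** The correlation of the linear part with g is controlled by Cauchy-Schwarz. *)
Lemma output_variance_close (G S : R) : 0 <= G -> 0 <= S ->
  E (fun w => edot (g w) (g w)) <= G ^+ 2 ->
  \tr (L^T *m second_moments *m L) <= S ^+ 2 ->
  `|output_variance - \tr (L^T *m second_moments *m L)| <= G ^+ 2 + 2 * (S * G).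
Proof.
move=> G0 S0 gG tS; rewrite /output_variance.
set V := \tr _; set X := E (fun w => edot (zO w) (g w)).
have := edot_mean_le bg; have := edot_ge0 (int_row P setT g).
have : `|X| <= S * G.
  rewrite -(ler_pXn2r (n := 2))// ?nnegrE ?mulr_ge0// real_normK ?num_real//.
  apply: le_trans (edot_cauchy_schwarz mT PT b_zO bg) _.
  rewrite exprMn ler_pM//; try by apply: int_ge0 => w _; exact: edot_ge0.
  by rewrite -trace_second_moments.
rewrite !ler_norml => /andP[x1 x2] h1 h2; apply/andP; split; lra.
Qed.

Lemma output_variance_ge0 : 0 <= output_variance.
Proof.
have := second_moment_about (int_row P setT W).
rewrite subrr edot0l add0r => <-; apply: int_ge0 => w _; exact: edot_ge0.
Qed.

(** Applied to squared distances, whose measurability is not known a priori; only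
    the function h compared with them is measurable. *)
Lemma integral_factor_close (f : T -> \bar R) (h : T -> R) (k : R) :
  0 <= k <= 1 -> bounded_mfun setT h -> (forall w, 0 <= h w) ->
  (forall w, exists2 y : R, f w = y%:E & (1 - k) * h w <= y <= (1 + k) * h w) ->
  exists2 y : R, (\int[P]_w f w)%E = y%:E & (1 - k) * E h <= y <= (1 + k) * E h.
Proof.
move=> /andP[k0 k1] bh h0 fh.
have k1' : 0 <= 1 - k by rewrite subr_ge0.
have lo : (((1 - k) * E h)%:E <= \int[P]_w f w)%E.
  rewrite -intZ// EFin_int//; last exact: bmZ.
  apply: le_integral_ge0 => w _; first by rewrite lee_fin mulr_ge0.
  by have [y -> /andP[? _]] := fh w; rewrite lee_fin.
have up : (\int[P]_w f w <= ((1 + k) * E h)%:E)%E.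
  rewrite -intZ// EFin_int//; last exact: bmZ.
  apply: le_integral_ge0 => w _; have [y -> /andP[y1 y2]] := fh w; rewrite lee_fin//.
  by apply: le_trans y1; rewrite mulr_ge0.
case: (\int[P]_w f w)%E lo up => [y| |]//; rewrite !lee_fin => lo up.
by exists y => //; rewrite lo.
Qed.

End Moments.

(** * The multiscale operator as a matrix *)

Section Vectorization.
Context (R : realType) (N q : nat).

Lemma sum_mxvec_index (F : 'I_(N * q) -> R) :
  \sum_i F i = \sum_i \sum_j F (mxvec_index i j).
Proof.
rewrite pair_bigA/= (reindex _ (curry_mxvec_bij N q))/=.
by apply: eq_bigr => -[i j].
Qed.

Lemma edot_mxvec (v w : 'M[R]_(N, q)) : edot (mxvec v) (mxvec w) = edot v w.
Proof.
rewrite edot_row sum_mxvec_index; apply: eq_bigr => i _; apply: eq_bigr => j _.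
by rewrite !mxvecE.
Qed.

Lemma enorm_mxvec (v : 'M[R]_(N, q)) : enorm (mxvec v) = enorm v.
Proof. by rewrite /enorm edot_mxvec. Qed.

Lemma opmxE (f : {linear 'M[R]_(N, q) -> 'rV[R]_q}) v : f v = mxvec v *m opmx f.
Proof.
have -> : opmx f = lin1_mx (f \o vec_mx) by [].
by rewrite mul_rV_lin1/= mxvecK.
Qed.

Lemma tr_mul_trmx n (L : 'M[R]_(n, q)) : \tr (L^T *m L) = \sum_i \sum_k L i k ^+ 2.
Proof.
rewrite /mxtrace exchange_big; apply: eq_bigr => k _; rewrite !mxE.
by apply: eq_bigr => i _; rewrite mxE expr2.
Qed.

Lemma opmx_tensor (f : 'M[R]_(N, q) -> 'rV[R]_q) (a : 'rV[R]_N) :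
  (forall v, f v = a *m v) -> \tr ((opmx f)^T *m opmx f) = q%:R * edot a a.
Proof.
move=> fa; rewrite tr_mul_trmx sum_mxvec_index edot_row mulr_sumr.
apply: eq_bigr => i _.
have opE j k : opmx f (mxvec_index i j) k = a 0 i * (j == k)%:R.
  rewrite /opmx /lin1_mx mxE fa -mxvec_delta mxvecK mxE (bigD1 i)//= big1 => [|l li].
    by rewrite mxE eqxx (eq_sym k) addr0.
  by rewrite mxE (negPf li) mulr0.
under eq_bigr => j _.
  rewrite (bigD1 j)//= big1 => [|k /negPf kj]; last first.
    by rewrite opE eq_sym kj mulr0 expr0n.
  rewrite opE eqxx mulr1 addr0; over.
by rewrite sumr_const card_ord expr2 mulr_natl.
Qed.

End Vectorization.

Section MultiscaleLinear.
Context (R : realType) (d q N : nat) (site : 'I_N -> borelRd R d).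
Variable Q : nat -> borelRd R d -> {linear 'M[R]_(N, q) -> 'rV[R]_q}.

Lemma residual_linear i a v w :
  residual site Q i (a *: v + w) = a *: residual site Q i v + residual site Q i w.
Proof.
elim: i => //= i ->; rewrite scalerBr addrACA -opprD; congr (_ - _).
by apply/matrixP => j k; rewrite !mxE linearP !mxE.
Qed.

Lemma multiscale_linear n x : linear (multiscale site Q n x).
Proof.
move=> a v w; elim: n => [|n ih] /=; first by rewrite scaler0 addr0.
by rewrite ih residual_linear linearP scalerDr addrACA.
Qed.

Lemma multiscaleE n x v :
  multiscale site Q n x v = mxvec v *m opmx (multiscale site Q n x).
Proof.
pose fL := GRing.isLinear.Build _ _ _ _ _ (multiscale_linear n x).
pose f : {linear 'M[R]_(N, q) -> 'rV[R]_q} := HB.pack (multiscale site Q n x) fL.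
exact: (opmxE f).
Qed.

End MultiscaleLinear.

Section OperatorBounds.
Context (R : realType) (n q : nat) (L : 'M[R]_(n, q)) (C : R).
Hypothesis L_le : forall v : 'rV[R]_n, enorm (v *m L) <= C * enorm v.

Lemma entry_le i k : `|L i k| <= C.
Proof.
have := L_le (delta_mx 0 i); rewrite -rowE => h.
have e1 : enorm (delta_mx 0 i : 'rV[R]_n) = 1.
  rewrite /enorm edot_row (bigD1 i)//= big1 => [|j /negPf ji].
    by rewrite mxE !eqxx mulr1 addr0 sqrtr1.
  by rewrite mxE ji andbF mulr0.
rewrite e1 mulr1 in h; apply: le_trans h.
by have := enorm_entry (row i L) 0 k; rewrite mxE.
Qed.

Lemma tr_mul_trmx_le : 0 <= C -> \tr (L^T *m L) <= (n * q)%:R * C ^+ 2.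
Proof.
move=> C0; rewrite tr_mul_trmx natrM -mulrA.
apply: (@le_trans _ _ (\sum_(i < n) q%:R * C ^+ 2)).
  apply: ler_sum => i _; apply: (@le_trans _ _ (\sum_(k < q) C ^+ 2)).
    apply: ler_sum => k _; rewrite -real_normK ?num_real// lerXn2r ?nnegrE//.
    exact: entry_le.
  by rewrite sumr_const card_ord mulr_natl.
by rewrite sumr_const card_ord (mulr_natl _ n).
Qed.

(** The trace is the sum of the quadratic form of S over the columns of L. *)
Lemma trace_perturbation (S : 'M[R]_n) (s b : R) : 0 <= b ->
  (forall v : 'rV[R]_n, enorm (v *m (S - s%:M)) <= b * enorm v) ->
  `|\tr (L^T *m S *m L) - s * \tr (L^T *m L)| <= b * \tr (L^T *m L).
Proof.
move=> b0 hS.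
have trE (B : 'M[R]_n) : \tr (L^T *m B *m L) = \sum_k edot (row k L^T *m B) (row k L^T).
  rewrite /mxtrace; apply: eq_bigr => k _; rewrite -row_mul edot_row [LHS]mxE.
  by apply: eq_bigr => i _; rewrite !mxE.
have -> : \tr (L^T *m S *m L) - s * \tr (L^T *m L) = \tr (L^T *m (S - s%:M) *m L).
  rewrite mulmxBr mulmxBl linearB/=; congr (_ - _).
  by rewrite mul_mx_scalar -scalemxAl linearZ.
have -> : \tr (L^T *m L) = \sum_k edot (row k L^T) (row k L^T).
  by rewrite -[L^T in LHS]mulmx1 trE; apply: eq_bigr => k _; rewrite mulmx1.
rewrite trE mulr_sumr; apply: le_trans (ler_norm_sum _ _ _) _.
apply: ler_sum => k _; apply: le_trans (edot_le _ _) _.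
by rewrite -edot_sqr expr2 mulrA ler_wpM2r ?enorm_ge0.
Qed.

End OperatorBounds.

Section Measurability.
Context (R : realType) (q : nat) (M : riemannian_manifold R q) (phi : chart R q M).
Context d (T : measurableType d).

Lemma measurable_cmap (Z : T -> M) k : atlas phi -> random_element Z ->
  (forall w, cdom phi (Z w)) -> measurable_fun setT (fun w => cmap phi (Z w) 0 k).
Proof.
move=> aphi mZ dZ.
apply: (measurability _ (RGenOInfty.measurableE R)) => _ [_ [x ->] <-].
rewrite setTI.
have -> : (fun w => cmap phi (Z w) 0 k) @^-1` `]x, +oo[ =
    Z @^-1` [set m | cdom phi m /\ x < cmap phi m 0 k].
  by apply/seteqP; split => w /=; rewrite in_itv/= andbT; [move=> ?; split|case].
apply: mZ; rewrite openE => m [mphi xm].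
have od : \forall m' \near m, cdom phi m'.
  by apply: open_nbhs_nbhs; split => //; case: (chart_open aphi).
have ox : \forall m' \near m, x < cmap phi m' 0 k.
  have cc : {for m, continuous (fun m' => cmap phi m' 0 k)}.
    apply: (@continuous_comp _ _ _ (cmap phi) (fun v : 'rV[R]_q => v 0 k)).
      exact: continuous_cmap.
    exact: coord_continuous.
  apply: (cc [set y | x < y]); apply: open_nbhs_nbhs; split => //.
by apply: filterS2 od ox => m' ? ?; split.
Qed.

End Measurability.

Section Covariance.
Context d (T : measurableType d) (R : realType) (P : probability T R).
Context (N q : nat).

Lemma mxvec_expectmx (Y : T -> 'M[R]_(N, q)) :
  mxvec (expectmx P Y) = int_row P setT (fun w => mxvec (Y w)).
Proof.
apply/rowP => k; case/mxvec_indexP: k => i j; rewrite mxvecE !mxE.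
by apply: eq_Rintegral => w _; rewrite mxvecE.
Qed.

Lemma covmxE (Y : T -> 'M[R]_(N, q)) :
  covmx P Y = second_moments P (fun w => mxvec (Y w)).
Proof.
apply/matrixP => k l; rewrite !mxE; apply: eq_Rintegral => w _.
by rewrite mxE big_ord1 mxE /centered !linearB/= mxvec_expectmx.
Qed.

End Covariance.

Section BoundedMeasurableMatrix.
Context d (T : measurableType d) (R : realType) (D : set T).

Lemma bm_trace n q (L : T -> 'M[R]_(n, q)) (S : 'M[R]_n) :
  (forall k l, bounded_mfun D (fun x => L x k l)) ->
  bounded_mfun D (fun x => \tr ((L x)^T *m S *m L x)).
Proof.
move=> bL; apply: (@eq_bm _ _ _ _
    (fun x => \sum_k \sum_j (\sum_i L x i k * S i j) * L x j k)).
  move=> x _; apply: eq_bigr => k _; rewrite [RHS]mxE; apply: eq_bigr => j _.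
  by rewrite [in RHS]mxE; congr (_ * _); apply: eq_bigr => i _; rewrite [in RHS]mxE.
apply: bm_sum => k; apply: bm_sum => j; apply: bmM => //; apply: bm_sum => i.
by apply: bmM => //; exact: bm_cst.
Qed.

Lemma bm_enorm q (X : T -> 'rV[R]_q) :
  bounded_mrow D X -> bounded_mfun D (fun x => enorm (X x)).
Proof.
move=> bX; have [mX [b Xb]] := bm_edot bX bX; split.
  apply: (measurableT_comp _ mX); apply: continuous_measurable_fun.
  exact: sqrt_continuous.
exists (Num.sqrt b) => x Dx; rewrite ger0_norm ?enorm_ge0// ler_wsqrtr//.
exact: le_trans (ler_norm _) (Xb x Dx).
Qed.

End BoundedMeasurableMatrix.

(** * Variance and mean square error at a point *)

(** The errors absorbed by the constants below are combinations of nonnegative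
    monomials in r and sigma with nonnegative coefficients. *)
Lemma sum_mul_le (R : realDomainType) (a b c a' b' c' : R) :
  0 <= a -> 0 <= b -> 0 <= c -> 0 <= a' -> 0 <= b' -> 0 <= c' ->
  a * a' + b * b' + c * c' <= (a + b + c) * (a' + b' + c').
Proof.
move=> a0 b0 c0 a'0 b'0 c'0.
have h1 := mulr_ge0 a0 b'0; have h2 := mulr_ge0 a0 c'0.
have h3 := mulr_ge0 b0 a'0; have h4 := mulr_ge0 b0 c'0.
have h5 := mulr_ge0 c0 a'0; have h6 := mulr_ge0 c0 b'0.
lra.
Qed.

Definition distance_close (R : realType) (q : nat) (M : riemannian_manifold R q)
    (phi : chart R q M) (rad k : R) : Prop :=
  forall x y, coord_ball phi rad x -> coord_ball phi rad y ->
  exists2 D : R, rho x y = D%:E &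
    let E := edot (cmap phi y - cmap phi x) (cmap phi y - cmap phi x) in
    (1 - k) * E <= D ^+ 2 <= (1 + k) * E.

Section Pointwise.
Context (R : realType) (q : nat) (M : riemannian_manifold R q) (phi : chart R q M).
Context d (T : measurableType d) (P : probability T R) (n : nat).
Local Notation V := 'rV[R]_q.
Variables (C C0 kappa r sigma : R).
Hypotheses (C_gt0 : 0 < C) (C0_gt0 : 0 < C0) (kappa_ge0 : 0 <= kappa).
Hypotheses (r01 : 0 < r <= 1) (s01 : 0 <= sigma <= 1) (k1 : kappa * r ^+ 2 <= 1).
Hypothesis aphi : atlas phi.
Hypothesis ball_cod : forall v : V, enorm v < C0 * r -> ccod phi v.
Let k := kappa * r ^+ 2.
Let rad := C0 * r.
Hypothesis rhoP : distance_close phi rad k.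

Variables (Y : T -> 'rV[R]_n) (L : 'M[R]_(n, q)) (Z : T -> M).
Hypothesis bY : bounded_mrow setT Y.
Hypothesis ZB : forall w, coord_ball phi rad (Z w).
Hypothesis mZ : random_element Z.
Hypothesis L_le : forall v : 'rV[R]_n, enorm (v *m L) <= C * enorm v.
Hypothesis consistent :
  {ae P, forall w, enorm (cmap phi (Z w) - Y w *m L) <= C * r ^+ 3}.
Hypothesis trS : \tr (second_moments P Y) <= C * sigma ^+ 2.

Local Notation E f := (Rintegral P setT f).
Let W (w : T) : V := cmap phi (Z w).
Let g (w : T) : V := W w - Y w *m L.
Let S := second_moments P Y.
Let Vx := \tr (L^T *m S *m L).
Let vs := output_variance P Y L g.

Let mT : measurable [set: T] := measurableT.
Let PT : (P [set: T] < +oo)%E. Proof. by rewrite probability_setT ltry. Qed.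

Let bW : bounded_mrow setT W.
Proof.
move=> j; split; first by apply: measurable_cmap => // w; case: (ZB w).
exists rad => w _; apply: le_trans (enorm_entry _ _ _) _.
by have [_ /ltW] := ZB w.
Qed.

Let bg : bounded_mrow setT g.
Proof. by apply: bmrowB => //; exact: bmrow_mul. Qed.

Let WE : W = (fun w => Y w *m L + g w).
Proof. by apply/funext => w; rewrite /g addrC subrK. Qed.

Let momentW b : E (fun w => edot (W w - b) (W w - b))
  = edot (int_row P setT W - b) (int_row P setT W - b) + vs.
Proof. rewrite WE; exact: second_moment_about. Qed.

Let Vx_ge0 : 0 <= Vx. Proof. exact: trace_second_moments_ge0. Qed.
Let vs_ge0 : 0 <= vs. Proof. exact: output_variance_ge0. Qed.

Let trace_le : Vx <= C ^+ 3 * sigma ^+ 2.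
Proof.
have bc : bounded_mrow setT (centered P Y) by apply: bmrowB => //; exact: bmrow_cst.
have -> : Vx = E (fun w => edot (centered P Y w *m L) (centered P Y w *m L)).
  exact: trace_second_moments.
have e1 : \tr S = E (fun w => edot (centered P Y w) (centered P Y w)).
  have := trace_second_moments P 1%:M bY; rewrite trmx1 mul1mx mulmx1 => ->.
  by apply: int_eq => w _; rewrite mulmx1.
apply: (@le_trans _ _ (C ^+ 2 * \tr S)); last first.
  by rewrite (exprSr C 2) -mulrA ler_wpM2l ?sqr_ge0.
rewrite e1 -(intZ mT PT); last exact: bm_edot.
apply: int_le => //; [by apply: bm_edot => //; exact: bmrow_mul|exact/bmZ/bm_edot|].
by move=> w _; rewrite -(edot_sqr (centered P Y w)) -exprMn edot_le_sqr.
Qed.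

Let g_le : E (fun w => edot (g w) (g w)) <= (C * r ^+ 3) ^+ 2.
Proof.
have -> : (C * r ^+ 3) ^+ 2 = (C * r ^+ 3) ^+ 2 * fine (P [set: T]).
  by rewrite probability_setT mulr1.
apply: int_le_ae => //; [exact: bm_edot|by move=> w _; exact: edot_ge0|exact: sqr_ge0|].
by apply: filterS consistent => w h _; exact: edot_le_sqr.
Qed.

Let delta := C ^+ 2 * r ^+ 6 + 2 * (C + 1) ^+ 2 * C * (r ^+ 3 * sigma).

Let vs_close : `|vs - Vx| <= delta.
Proof.
have [r0 _] := andP r01; have [s0 _] := andP s01.
have G0 : 0 <= C * r ^+ 3 by rewrite mulr_ge0 ?exprn_ge0 ?(ltW C_gt0) ?(ltW r0).
have S0 : 0 <= (C + 1) ^+ 2 * sigma by rewrite mulr_ge0 ?sqr_ge0.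
have VS : Vx <= ((C + 1) ^+ 2 * sigma) ^+ 2.
  apply: le_trans trace_le _; rewrite exprMn ler_wpM2r ?sqr_ge0//.
  have h1 := exprn_ge0 2 (ltW C_gt0); have h2 := exprn_ge0 3 (ltW C_gt0).
  have h3 := exprn_ge0 4 (ltW C_gt0); have h4 := ltW C_gt0; lra.
have := output_variance_close bY bg G0 S0 g_le VS.
rewrite -/vs -/S -/Vx => h; apply: le_trans h _.
by rewrite /delta le_eqVlt; apply/orP; left; apply/eqP; ring.
Qed.

(** Reduces mean square distances to Euclidean moments of the logarithms. *)
Lemma msd_close y : coord_ball phi rad y ->
  let m := edot (int_row P setT W - cmap phi y) (int_row P setT W - cmap phi y) + vs in
  exists2 v : R, mean_sq_dist P y Z = v%:E & (1 - k) * m <= v <= (1 + k) * m.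
Proof.
move=> By m.
rewrite /m -momentW; apply: integral_factor_close.
- by rewrite k1 mulr_ge0 ?sqr_ge0.
- by apply: bm_edot; apply: bmrowB => //; exact: bmrow_cst.
- by move=> w; exact: edot_ge0.
- move=> w; have [D -> h] := rhoP By (ZB w).
  by exists (D ^+ 2) => //; rewrite EFin_expe.
Qed.

Let k0 : 0 <= k. Proof. by rewrite mulr_ge0 ?sqr_ge0. Qed.

Let EW_le : enorm (int_row P setT W) <= rad.
Proof.
have rad0 : 0 <= rad by rewrite mulr_ge0 ?(ltW C0_gt0)//; case/andP: r01 => /ltW.
apply: enorm_le => //; apply: le_trans (edot_mean_le P bW) _.
have -> : rad ^+ 2 = E (fun=> rad ^+ 2).
  by rewrite (int_cst P mT) -[X in fine X]/(P [set: T]) probability_setT mulr1.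
apply: int_le => //; [exact: bm_edot|exact: bm_cst|].
by move=> w _; apply: edot_le_sqr; have [_ /ltW] := ZB w.
Qed.

Definition var_const := kappa * C ^+ 3 + 4 * (C + 1) ^+ 2 * C + (2 * C ^+ 2 + 2 * C0 ^+ 2).

(** The factor comparison at ybar itself bounds the variance from below, since vs is
    the least second moment of W.  For the upper bound, minimality of ybar allows
    another centre: the point whose logarithm is the expectation of W, pulled
    towards p by the factor 1 - r^3 so that it lies strictly inside the ball. *)
Lemma var_close ybar : coord_ball phi rad ybar -> intrinsic_mean P Z ybar ->
  exists2 v : R, mean_sq_dist P ybar Z = v%:E &
    `|v - Vx| <= var_const * (r ^+ 2 * sigma ^+ 2 + r ^+ 3 * sigma + r ^+ 6).
Proof.
move=> By mean; have [r0 r1] := andP r01; have [s0 s1] := andP s01.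
have [v ve /andP[v1 v2]] := msd_close By.
exists v => //.
set m := int_row P setT W.
have r3 : 0 < r ^+ 3 <= 1 by rewrite exprn_gt0//= exprn_ile1// ltW.
have [r30 r31] := andP r3.
have rad0 : 0 < rad by rewrite mulr_gt0.
pose b : V := (1 - r ^+ 3) *: m.
have br : enorm b < rad.
  rewrite /b enormZ ger0_norm ?subr_ge0//.
  apply: le_lt_trans (_ : (1 - r ^+ 3) * rad < _); last by rewrite gtr_pMl// ltrBlDr ltrDl.
  by rewrite ler_wpM2l ?subr_ge0.
have Bb : coord_ball phi rad (cinv phi b).
  by split; [apply: cinv_dom => //; exact: ball_cod|rewrite cinvK//; exact: ball_cod].
have [v' v'e /andP[_ v'2]] := msd_close Bb.
have vv' : v <= v' by have := mean (cinv phi b); rewrite ve v'e lee_fin.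
rewrite cinvK in v'2 => //; last exact: ball_cod.
have mb : edot (m - b) (m - b) <= C0 ^+ 2 * r ^+ 6.
  have -> : m - b = r ^+ 3 *: m by rewrite /b scalerBl scale1r opprB addrC subrK.
  rewrite edotZl edotZr mulrA -expr2 -exprM.
  have := edot_le_sqr EW_le; rewrite -/m => h.
  have : r ^+ 6 * edot m m <= r ^+ 6 * (C0 ^+ 2 * 1).
    rewrite ler_wpM2l ?exprn_ge0 ?(ltW r0)//; apply: le_trans h _.
    by rewrite exprMn ler_wpM2l ?sqr_ge0// exprn_ile1// ltW.
  lra.
have low : (1 - k) * vs <= v.
  apply: le_trans v1; rewrite ler_wpM2l ?subr_ge0// lerDr edot_ge0.
  by [].
have C02 : 0 <= C0 ^+ 2 * r ^+ 6 by rewrite mulr_ge0 ?sqr_ge0 ?exprn_ge0 ?(ltW r0).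
have up : v <= (1 + k) * (C0 ^+ 2 * r ^+ 6 + vs).
  apply: le_trans vv' _; apply: le_trans v'2 _.
  by rewrite ler_wpM2l ?addr_ge0// lerD2r.
have := vs_close; rewrite ler_norml => /andP[d1 d2].
have kk : k * (C0 ^+ 2 * r ^+ 6) <= C0 ^+ 2 * r ^+ 6 by rewrite ler_piMl.
have kv : k * vs <= k * (C ^+ 3 * sigma ^+ 2) + delta.
  apply: (@le_trans _ _ (k * (C ^+ 3 * sigma ^+ 2 + delta))).
    by rewrite ler_wpM2l//; have := trace_le; lra.
  rewrite mulrDr lerD2l ler_piMl//.
  by have := vs_close; apply: le_trans.
have c1 : 0 <= kappa * C ^+ 3 by rewrite mulr_ge0 ?exprn_ge0 ?(ltW C_gt0).
have c2 : 0 <= 4 * (C + 1) ^+ 2 * C by rewrite mulr_ge0 ?(ltW C_gt0)// mulr_ge0 ?sqr_ge0.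
have c3 : 0 <= 2 * C ^+ 2 + 2 * C0 ^+ 2 by apply: addr_ge0; apply: mulr_ge0 => //; exact: sqr_ge0.
have m1 : 0 <= r ^+ 2 * sigma ^+ 2 by rewrite mulr_ge0 ?sqr_ge0.
have m2 : 0 <= r ^+ 3 * sigma by rewrite mulr_ge0 ?(ltW r30).
have m3 : 0 <= r ^+ 6 by rewrite exprn_ge0 ?(ltW r0).
apply: le_trans (sum_mul_le c1 c2 c3 m1 m2 m3).
have -> : kappa * C ^+ 3 * (r ^+ 2 * sigma ^+ 2) = k * (C ^+ 3 * sigma ^+ 2).
  by rewrite /k; ring.
rewrite ler_norml; rewrite /delta in d1 d2 kv; apply/andP; split; lra.
Qed.

Definition mse_const := (kappa + 4 * (C ^+ 2 + C))
  + (kappa * C ^+ 3 + 2 * (C ^+ 2 + C) ^+ 2 + 2 * C ^+ 2 + 4 * (C + 1) ^+ 2 * C).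

(** Here the moment is taken about u = log_p F.  It lies at distance |e| + O(chi)
    from the mean of W, because the bias of the noise and the linearization error
    displace the mean from A u_X by O(sigma^2) and O(r^3). *)
Lemma mse_close y (uX : 'rV[R]_n) : coord_ball phi rad y ->
  enorm (int_row P setT Y - uX) <= C * sigma ^+ 2 ->
  let chi := r ^+ 3 + sigma ^+ 2 in
  let e := cmap phi y - uX *m L in
  exists2 v : R, mean_sq_dist P y Z = v%:E &
    `|v - (enorm e ^+ 2 + Vx)| <= mse_const * (r ^+ 2 * enorm e ^+ 2 + chi * enorm e
       + (r ^+ 2 * sigma ^+ 2 + chi * sigma + chi ^+ 2)).
Proof.
move=> By beta chi e; have [r0 r1] := andP r01; have [s0 s1] := andP s01.
have [v ve /andP[v1 v2]] := msd_close By.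
exists v => //.
have C0' := ltW C_gt0.
have r3 : 0 <= r ^+ 3 by rewrite exprn_ge0// ltW.
have chi0 : 0 <= chi by rewrite addr_ge0 ?sqr_ge0.
pose t := (int_row P setT Y - uX) *m L + int_row P setT g.
have me : int_row P setT W - cmap phi y = t - e.
  rewrite WE output_mean// /t /e mulmxBl.
  by apply/rowP => j; rewrite !mxE; ring.
have te : enorm t <= (C ^+ 2 + C) * chi.
  apply: le_trans (enormD _ _) _.
  have h1 : enorm ((int_row P setT Y - uX) *m L) <= C * (C * sigma ^+ 2).
    by apply: le_trans (L_le _) _; rewrite ler_wpM2l.
  have h2 : enorm (int_row P setT g) <= C * r ^+ 3.
    apply: enorm_le; first by rewrite mulr_ge0.
    exact: le_trans (edot_mean_le P bg) g_le.
  have h3 : 0 <= C ^+ 2 * r ^+ 3 by rewrite mulr_ge0 ?sqr_ge0.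
  have h4 : 0 <= C * sigma ^+ 2 by rewrite mulr_ge0 ?sqr_ge0.
  rewrite /chi; lra.
have e0 := enorm_ge0 e.
set A := (C ^+ 2 + C) in te *.
have A0 : 0 <= A by rewrite addr_ge0 ?sqr_ge0.
set x := enorm e in e0 *.
have Ne : `|edot (t - e) (t - e) - x ^+ 2| <= 2 * (A * (chi * x)) + A ^+ 2 * chi ^+ 2.
  have sq (u v0 : V) : edot (u - v0) (u - v0) - enorm v0 ^+ 2 = edot u u - 2 * edot u v0.
    by rewrite edot_sqr !(edotDl, edotDr, edotNl, edotNr) (edotC v0 u); ring.
  rewrite sq; apply: le_trans (ler_normB _ _) _; rewrite
    normrM (ger0_norm (edot_ge0 _)) [`|2|]ger0_norm//.
  have h1 := edot_le_sqr te; rewrite exprMn in h1.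
  have h2 : `|edot t e| <= A * chi * x.
    by apply: le_trans (edot_le _ _) _; rewrite ler_wpM2r.
  lra.
rewrite me in v1 v2.
set N := edot (t - e) (t - e) in Ne v1 v2 *.
have N0 : 0 <= N by exact: edot_ge0.
move: Ne; rewrite ler_norml => /andP[n1 n2].
have := vs_close; rewrite ler_norml => /andP[d1 d2].
set B := 2 * (A * (chi * x)) + A ^+ 2 * chi ^+ 2 in n1 n2.
have B0 : 0 <= B.
  apply: addr_ge0; last by apply: mulr_ge0; exact: sqr_ge0.
  by rewrite mulr_ge0// mulr_ge0// mulr_ge0.
have del0 : 0 <= delta by have := vs_close; apply: le_trans.
have kv : k * (N + vs) <= k * x ^+ 2 + k * (C ^+ 3 * sigma ^+ 2) + B + delta.
  apply: (@le_trans _ _ (k * ((x ^+ 2 + C ^+ 3 * sigma ^+ 2) + (B + delta)))).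
    by rewrite ler_wpM2l//; have := trace_le; lra.
  have : k * (B + delta) <= B + delta by rewrite ler_piMl// addr_ge0.
  rewrite !mulrDr; lra.
have q1 : r ^+ 6 <= chi ^+ 2.
  rewrite (_ : r ^+ 6 = (r ^+ 3) ^+ 2); last by rewrite -exprM.
  by rewrite lerXn2r ?nnegrE// lerDl sqr_ge0.
have q2 : r ^+ 3 * sigma <= chi * sigma by rewrite ler_wpM2r// lerDl sqr_ge0.
have p1 : C ^+ 2 * r ^+ 6 <= C ^+ 2 * chi ^+ 2 by rewrite ler_wpM2l ?sqr_ge0.
have c4 : 0 <= 2 * (C + 1) ^+ 2 * C by rewrite mulr_ge0 ?(ltW C_gt0)// mulr_ge0 ?sqr_ge0.
have p2 := ler_wpM2l c4 q2.
have total : `|v - (x ^+ 2 + Vx)| <= kappa * (r ^+ 2 * x ^+ 2) + 4 * A * (chi * x)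
    + (kappa * C ^+ 3 * (r ^+ 2 * sigma ^+ 2) + 4 * (C + 1) ^+ 2 * C * (chi * sigma)
       + (2 * A ^+ 2 + 2 * C ^+ 2) * chi ^+ 2).
  have kE1 : kappa * (r ^+ 2 * x ^+ 2) = k * x ^+ 2 by rewrite /k; ring.
  have kE2 : kappa * C ^+ 3 * (r ^+ 2 * sigma ^+ 2) = k * (C ^+ 3 * sigma ^+ 2).
    by rewrite /k; ring.
  rewrite kE1 kE2 ler_norml; rewrite /delta in d1 d2 kv.
  rewrite /B in n1 n2 kv; apply/andP; split; lra.
apply: le_trans total _.
have a1 : 0 <= r ^+ 2 * x ^+ 2 by rewrite mulr_ge0 ?sqr_ge0.
have a2 : 0 <= chi * x by rewrite mulr_ge0.
have a3 : 0 <= r ^+ 2 * sigma ^+ 2 by rewrite mulr_ge0 ?sqr_ge0.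
have a4 : 0 <= chi * sigma by rewrite mulr_ge0.
have a5 : 0 <= chi ^+ 2 by rewrite sqr_ge0.
have b3 : 0 <= kappa * C ^+ 3 by rewrite mulr_ge0 ?exprn_ge0.
have b4 : 0 <= 4 * (C + 1) ^+ 2 * C by rewrite mulr_ge0 ?(ltW C_gt0)// mulr_ge0 ?sqr_ge0.
have b5 : 0 <= 2 * A ^+ 2 + 2 * C ^+ 2 by apply: addr_ge0; apply: mulr_ge0 => //; exact: sqr_ge0.
have s1' := sum_mul_le b3 b4 b5 a3 a4 a5.
have b1 : 0 <= 4 * A by rewrite mulr_ge0.
have b345 := addr_ge0 (addr_ge0 b3 b4) b5.
have a345 := addr_ge0 (addr_ge0 a3 a4) a5.
have s2' := sum_mul_le kappa_ge0 b1 b345 a1 a2 a345.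
have -> : mse_const = kappa + 4 * A
    + (kappa * C ^+ 3 + 4 * (C + 1) ^+ 2 * C + (2 * A ^+ 2 + 2 * C ^+ 2)).
  by rewrite /mse_const /A; ring.
by apply: le_trans s2'; rewrite lerD2l.
Qed.

End Pointwise.

(** * Integration over the domain *)

Definition distance_const (R : realType) (C C0 : R) := metric_const C * C0 ^+ 2.

(** The relative error of the metric is quadratic in the radius C0 r, and it passes
    to squared distances. *)
Lemma normal_chart_distance_close (R : realType) (q : nat)
    (M : riemannian_manifold R q) (phi : chart R q M) (p : M) (C C0 r : R) :
  0 < C -> 4 * C ^+ 2 * (C0 * r) <= 1 ->
  normal_chart phi p (C0 * r) -> strongly_convex (coord_ball phi (C0 * r)) ->
  sectional_curvature_bounded phi (C0 * r) C ->
  chart_derivatives_bounded phi (C0 * r) C ->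
  distance_close phi (C0 * r) (distance_const C C0 * r ^+ 2).
Proof.
move=> C_gt0 small normal convex curv chart.
have [[aphi _] _ m0 cod _] := normal.
have k0 : 0 <= distance_const C C0 * r ^+ 2.
  rewrite mulr_ge0 ?sqr_ge0// mulr_ge0 ?sqr_ge0//.
  by apply: addr_ge0; apply: mulr_ge0 => //; [exact: sqr_ge0|exact: ltW].
move=> x y Bx By; apply: (rho_chart normal convex k0) => // z v zr.
have := @metric_second_order R q (metric phi) (ccod phi)
  (chart_open aphi).2 (Defs.metric_smooth aphi) (Defs.metric_sym aphi) (Defs.metric_pos aphi)
  (C0 * r) C cod m0 (normal_chart_Gamma normal) C_gt0
  (fun y v yr => (chart y v yr).1) (fun y v yr => (chart y v yr).2) small curv z v zr.
move=> h; apply: le_trans h _; rewrite mulrA ler_wpM2r ?edot_ge0//.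
have : edot z z <= (C0 * r) ^+ 2 by apply: edot_le_sqr; exact: ltW.
rewrite exprMn /distance_const -mulrA; apply: ler_wpM2l.
by apply: addr_ge0; apply: mulr_ge0 => //; [exact: sqr_ge0|exact: ltW].
Qed.

Theorem lemma3p9 (R : realType) (d q N n : nat) (C0 C m : R)
    (C0_gt0 : 0 < C0) (C_gt0 : 0 < C) :
  exists K r0 : R, 0 < r0 <= 1 /\
  forall (M : riemannian_manifold R q) (p : M) (phi : chart R q M)
    (dP : measure_display) (T : measurableType dP) (P : probability T R)
    (* sites, hierarchy, Euclidean level operators *)
    (site : 'I_N -> borelRd R d) (X : nat -> {set 'I_N})
    (Q : nat -> borelRd R d -> {linear 'M[R]_(N, q) -> 'rV[R]_q})
    (* target, noisy samples, manifold scheme (level, point, samples) *)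
    (F : borelRd R d -> M) (Feps : 'I_N -> T -> M)
    (S : nat -> borelRd R d -> ('I_N -> M) -> M)
    (Omega : set (borelRd R d))
    (mu : {measure set (borelRd R d) -> \bar R})
    (Fbar : borelRd R d -> M) (r sigma : R),
  let Ft i x w := S i x (fun j => Feps j w) in
  let A := multiscale site Q n in
  let B := coord_ball phi (C0 * r) in
  let u x := cmap phi (F x) in
  let uX := logmx phi (fun j => F (site j)) in
  let ueps w := logmx phi (fun j => Feps j w) in
  let Sigma := covmx P ueps in
  let var x := mean_sq_dist P (Fbar x) (Ft n x) in
  let mse x := mean_sq_dist P (F x) (Ft n x) in
  let chi := r ^+ 3 + sigma ^+ 2 in
  let e x := u x - A x uX in
  let Bn2 := Rintegral mu Omega (fun x => enorm (e x) ^+ 2) in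
  let Bn := Num.sqrt Bn2 in
  let Vn := Rintegral mu Omega
    (fun x => \tr ((opmx (A x))^T *m Sigma *m opmx (A x))) in
  let In := Rintegral mu Omega
    (fun x => \tr ((opmx (A x))^T *m opmx (A x))) in
  let IVar := (\int[mu]_(x in Omega) var x)%E in
  let MISE := (\int[mu]_(x in Omega) mse x)%E in
  0 < r <= r0 -> 0 <= sigma <= r0 ->
  (* nested hierarchy *)
  (forall i, (0 < i < n)%N -> X i \subset X i.+1) ->
  X n = [set: 'I_N]%SET -> level_supported Q X n ->
  (* measurability *)
  measurable Omega -> (mu Omega <= m%:E)%E ->
  (forall j, random_element (Feps j)) ->
  (forall x, Omega x -> random_element (Ft n x)) ->
  (forall k, measurable_fun Omega (fun x => u x 0 k)) ->
  (forall k l, measurable_fun Omega (fun x => opmx (A x) k l)) ->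
  measurable_fun Omega var -> measurable_fun Omega mse ->
  (* local geometry *)
  normal_chart phi p (C0 * r) -> strongly_convex B ->
  sectional_curvature_bounded phi (C0 * r) C ->
  chart_derivatives_bounded phi (C0 * r) C ->
  (forall x, Omega x -> B (F x)) -> (forall j, B (F (site j))) ->
  (forall j w, B (Feps j w)) ->
  (forall i x w, (i <= n)%N -> Omega x \/ range site x -> B (Ft i x w)) ->
  (* local consistency *)
  (forall x, Omega x -> {ae P, forall w,
     enorm (cmap phi (Ft n x w) - A x (ueps w)) <= C * r ^+ 3}) ->
  (* coordinate noise *)
  {ae P, forall w, enorm (ueps w - uX) <= C * r} ->
  enorm (expectmx P ueps - uX) <= C * sigma ^+ 2 ->
  \tr Sigma <= C * sigma ^+ 2 ->
  (* uniform bound on A_n, intrinsic mean *)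
  (forall x, Omega x -> forall v, enorm (A x v) <= C * enorm v) ->
  (forall x, Omega x -> B (Fbar x) /\ unique_intrinsic_mean P (Ft n x) (Fbar x)) ->
  [/\ (`| IVar - Vn%:E | <=
        (K * (r ^+ 2 * sigma ^+ 2 + r ^+ 3 * sigma + r ^+ 6))%:E)%E,
      (`| MISE - (Bn2 + Vn)%:E | <=
        (K * (r ^+ 2 * Bn2 + chi * Bn + r ^+ 2 * sigma ^+ 2
              + chi * sigma + chi ^+ 2))%:E)%E,
      (forall v : 'rV[R]_(N * q),
         enorm (v *m (Sigma - (sigma ^+ 2)%:M)) <= C * r * sigma ^+ 2 * enorm v) ->
      `| Vn - sigma ^+ 2 * In | <= K * (r * sigma ^+ 2) &
      forall a : borelRd R d -> 'rV[R]_N,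
        (* (a (x) I_q) acts on N x q data by left multiplication *)
        (forall x, Omega x -> forall v, A x v = a x *m v) ->
        sigma ^+ 2 * In
        = q%:R * sigma ^+ 2 * Rintegral mu Omega (fun x => enorm (a x) ^+ 2)].
Proof.
pose kappa := distance_const C C0.
have kappa0 : 0 <= kappa.
  rewrite mulr_ge0 ?sqr_ge0//.
  by apply: addr_ge0; apply: mulr_ge0 => //; [exact: sqr_ge0|exact: ltW].
have C_ge0 := ltW C_gt0.
have mexp (a : R) k : 0 <= a -> 0 <= a ^+ k by exact: exprn_ge0.
have K1 : 0 <= var_const C C0 kappa.
  rewrite /var_const; apply: addr_ge0; first apply: addr_ge0.
  - by rewrite mulr_ge0 ?mexp.
  - by rewrite mulr_ge0// mulr_ge0 ?sqr_ge0.
  - by apply: addr_ge0; apply: mulr_ge0 => //; exact: sqr_ge0.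
have K2 : 0 <= mse_const C kappa.
  rewrite /mse_const; apply: addr_ge0; first apply: addr_ge0 => //.
    by rewrite mulr_ge0// addr_ge0 ?sqr_ge0.
  apply: addr_ge0; last by rewrite mulr_ge0// mulr_ge0 ?sqr_ge0.
  apply: addr_ge0; last by apply: mulr_ge0 => //; exact: sqr_ge0.
  apply: addr_ge0; last by apply: mulr_ge0 => //; exact: sqr_ge0.
  by rewrite mulr_ge0 ?mexp.
pose k3 := C * ((N * q * q)%:R * C ^+ 2).
have K3 : 0 <= k3 by rewrite mulr_ge0// mulr_ge0// sqr_ge0.
have M1 : 1 <= 1 + `|m| by rewrite lerDl.
have M0 : 0 <= 1 + `|m| by apply: le_trans M1.
(* 1 + |m| bounds the mass of Omega, and its square bounds the mass as well,
   which absorbs the square root in the Cauchy-Schwarz step for |e| *)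
pose K := (1 + `|m|) * (var_const C C0 kappa + mse_const C kappa + k3).
(* r <= 1 / den makes both 4 C^2 C0 r and kappa r^2 at most 1 *)
pose den := 1 + (4 * C ^+ 2 * C0 + kappa).
have c4 : 0 <= 4 * C ^+ 2 * C0.
  by rewrite mulr_ge0 ?(ltW C0_gt0)// mulr_ge0// sqr_ge0.
have den1 : 1 <= den by rewrite lerDl addr_ge0.
have den0 : 0 < den by apply: lt_le_trans den1.
exists K, den^-1; split; first by rewrite invr_gt0 den0 invf_le1.
move=> M p phi dP T P site X Q F Feps S Omega mu Fbar r sigma.
move=> Ft A B u uX ueps Sigma var mse chi e Bn2 Bn Vn In IVar MISE.
move=> /andP[r0 rden] /andP[s0 sden] _ _ _ mO muO mFeps mFt mu_ mL mvar mmse.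
move=> normal convex curv chart FB FsB FepsB FtB consist noise beta trS Abound mean.
have [[aphi _] _ _ cod _] := normal.
have den_r1 : den * r <= 1 by rewrite -ler_pdivlMl// mulr1.
have r1 : r <= 1 by apply: le_trans rden _; rewrite invf_le1.
have s1 : sigma <= 1 by apply: le_trans sden _; rewrite invf_le1.
have r01 : 0 < r <= 1 by rewrite r0.
have s01 : 0 <= sigma <= 1 by rewrite s0.
have kr : 0 <= kappa * r by rewrite mulr_ge0// ltW.
have cr : 0 <= 4 * C ^+ 2 * C0 * r by rewrite mulr_ge0// ltW.
have small : 4 * C ^+ 2 * (C0 * r) <= 1.
  by move: den_r1; rewrite /den mulrA; lra.
have k1 : kappa * r ^+ 2 <= 1.
  apply: (@le_trans _ _ (kappa * r)).
    by rewrite ler_wpM2l// expr2 ler_piMr// ltW.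
  by move: den_r1; rewrite /den; lra.
have rhoP := normal_chart_distance_close C_gt0 small normal convex curv chart.
pose Y w := mxvec (ueps w).
pose L x := opmx (A x).
have AE x v : A x v = mxvec v *m L x by exact: multiscaleE.
have SE : Sigma = second_moments P Y by exact: covmxE.
have EY : int_row P setT Y = mxvec (expectmx P ueps) by rewrite mxvec_expectmx.
have bY : bounded_mrow setT Y.
  move=> k; case/mxvec_indexP: k => i j.
  have YE w : Y w 0 (mxvec_index i j) = cmap phi (Feps i w) 0 j.
    by rewrite mxvecE mxE.
  split.
    under eq_fun do rewrite YE; apply: measurable_cmap => // w.
    by case: (FepsB i w).
  exists (C0 * r) => w _; rewrite YE; apply: le_trans (enorm_entry _ _ _) _.
  by case: (FepsB i w) => _ /ltW.
have L_le x : Omega x -> forall v : 'rV[R]_(N * q), enorm (v *m L x) <= C * enorm v.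
  move=> Ox v; have := Abound x Ox (vec_mx v).
  by rewrite AE -(enorm_mxvec (vec_mx v)) vec_mxK.
have cons x : Omega x ->
    {ae P, forall w, enorm (cmap phi (Ft n x w) - Y w *m L x) <= C * r ^+ 3}.
  by move=> /consist; apply: filterS => w; rewrite AE.
have ZB x : Omega x -> forall w, coord_ball phi (C0 * r) (Ft n x w).
  by move=> Ox w; apply: FtB => //; left.
have trS' : \tr (second_moments P Y) <= C * sigma ^+ 2 by rewrite -SE.
have beta' : enorm (int_row P setT Y - mxvec uX) <= C * sigma ^+ 2.
  have -> : int_row P setT Y - mxvec uX = mxvec (expectmx P ueps - uX).
    by rewrite linearB EY.
  by rewrite enorm_mxvec.
have muoo : (mu Omega < +oo)%E by apply: le_lt_trans muO (ltry _).
have mass0 : 0 <= fine (mu Omega) by rewrite fine_ge0.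
have massm : fine (mu Omega) <= 1 + `|m|.
  have mfin : mu Omega \is a fin_num by rewrite ge0_fin_numE.
  have : fine (mu Omega) <= m by rewrite -lee_fin fineK.
  by have := ler_norm m; lra.
have bL k l : bounded_mfun Omega (fun x => L x k l).
  split; first exact: mL.
  by exists C => x Ox; exact/entry_le/L_le.
have bV : bounded_mfun Omega (fun x => \tr ((L x)^T *m Sigma *m L x)) by exact: bm_trace.
have bI : bounded_mfun Omega (fun x => \tr ((L x)^T *m L x)).
  by apply: eq_bm (bm_trace 1%:M bL) => x _; rewrite mulmx1.
have be : bounded_mrow Omega e.
  apply: bmrowB => k.
    split; first exact: mu_.
    exists (C0 * r) => x Ox; apply: le_trans (enorm_entry _ _ _) _.
    by case: (FB x Ox) => _ /ltW.
  apply: (@eq_bm _ _ _ _ (fun x => \sum_i mxvec uX 0 i * L x i k)).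
    by move=> x _; rewrite AE mxE.
  by apply: bm_sum => i; exact: bmZ.
have bne := bm_enorm be.
have bne2 : bounded_mfun Omega (fun x => enorm (e x) ^+ 2) by exact: bmM.
have int_cst_le a : 0 <= a -> Rintegral mu Omega (fun=> a) <= a * (1 + `|m|).
  by move=> a0; rewrite int_cst// ler_wpM2l.
have KE b : 0 <= b <= var_const C C0 kappa + mse_const C kappa + k3 ->
    forall a, 0 <= a -> b * a * (1 + `|m|) <= K * a.
  move=> /andP[b0 bK] a a0; rewrite mulrAC ler_wpM2r// mulrC /K ler_wpM2l//.
have chi0 : 0 <= chi by rewrite addr_ge0 ?sqr_ge0// exprn_ge0// ltW.
have Bn2_ge0 : 0 <= Bn2 by apply: int_ge0 => x _; exact: sqr_ge0.
have Bn_ge0 : 0 <= Bn by exact: sqrtr_ge0.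
have a1 : 0 <= r ^+ 2 * sigma ^+ 2 by rewrite mulr_ge0 ?sqr_ge0.
have a2 : 0 <= r ^+ 3 * sigma by rewrite mulr_ge0// exprn_ge0// ltW.
have a3 : 0 <= r ^+ 6 by rewrite exprn_ge0// ltW.
have a4 : 0 <= chi * sigma by rewrite mulr_ge0.
have a5 : 0 <= chi ^+ 2 by rewrite sqr_ge0.
split.
- pose err := r ^+ 2 * sigma ^+ 2 + r ^+ 3 * sigma + r ^+ 6.
  have err0 : 0 <= err by rewrite !addr_ge0.
  apply: (@le_trans _ _ (Rintegral mu Omega (fun=> var_const C C0 kappa * err))%:E).
    apply: (int_close mO muoo mvar bV); first exact: bm_cst.
    move=> x Ox; have [Bx [mx _]] := mean x Ox; rewrite SE.
    exact: (var_close C_gt0 C0_gt0 kappa0 r01 s01 k1 aphi cod rhoP bY (ZB x Ox)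
      (mFt x Ox) (L_le x Ox) (cons x Ox) trS' Bx mx).
  rewrite lee_fin; apply: le_trans (int_cst_le _ _) _; first by rewrite mulr_ge0.
  by apply: KE => //; rewrite K1/= -addrA lerDl addr_ge0.
- pose rest := r ^+ 2 * sigma ^+ 2 + chi * sigma + chi ^+ 2.
  have rest0 : 0 <= rest by rewrite !addr_ge0.
  pose err x := mse_const C kappa *
    (r ^+ 2 * enorm (e x) ^+ 2 + chi * enorm (e x) + rest).
  have b1 := bmZ (r ^+ 2) bne2; have b2 := bmZ chi bne.
  have b3 := bm_cst Omega rest.
  have b12 := bmD b1 b2; have b123 := bmD b12 b3.
  have -> : Bn2 + Vn = Rintegral mu Omega
      (fun x => enorm (e x) ^+ 2 + \tr ((L x)^T *m Sigma *m L x)) by rewrite intD.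
  apply: (@le_trans _ _ (Rintegral mu Omega err)%:E).
    apply: (int_close mO muoo mmse (bmD bne2 bV)); first exact: bmZ.
    move=> x Ox.
    have := mse_close C_gt0 kappa0 r01 s01 k1 aphi rhoP bY (ZB x Ox) (mFt x Ox)
      (L_le x Ox) (cons x Ox) trS' (FB x Ox) beta'.
    by rewrite -AE -SE.
  rewrite lee_fin /err intZ// intD// intD// intZ// intZ//.
  have ne : Rintegral mu Omega (fun x => enorm (e x)) <= (1 + `|m|) * Bn.
    have I0 : 0 <= Rintegral mu Omega (fun x => enorm (e x)).
      by apply: int_ge0 => x _; exact: enorm_ge0.
    rewrite -(ler_pXn2r (n := 2))// ?nnegrE ?mulr_ge0//.
    have := int_cauchy_schwarz mO muoo bne (bm_cst Omega 1).
    under [in X in X ^+ 2]int_eq do rewrite mulr1.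
    rewrite int_cst// expr1n mul1r => h; apply: le_trans h _.
    rewrite exprMn sqr_sqrtr// mulrC ler_wpM2r//.
    by apply: le_trans massm _; rewrite expr2 ler_peMl.
  have h1 : r ^+ 2 * Bn2 <= r ^+ 2 * Bn2 * (1 + `|m|).
    by rewrite ler_peMr// mulr_ge0 ?sqr_ge0.
  have h2 : chi * Rintegral mu Omega (fun x => enorm (e x)) <= chi * Bn * (1 + `|m|).
    by rewrite -mulrA ler_wpM2l// mulrC.
  have h3 := int_cst_le rest rest0.
  apply: (@le_trans _ _ (mse_const C kappa * (r ^+ 2 * Bn2 + chi * Bn + rest) * (1 + `|m|))).
    rewrite -mulrA ler_wpM2l//; apply: le_trans (lerD (lerD h1 h2) h3) _.
    by rewrite -2!mulrDl.
  have -> : r ^+ 2 * Bn2 + chi * Bn + r ^+ 2 * sigma ^+ 2 + chi * sigma + chi ^+ 2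
      = r ^+ 2 * Bn2 + chi * Bn + rest by rewrite /rest !addrA.
  apply: KE; last first.
    by apply: addr_ge0 rest0; apply: addr_ge0; apply: mulr_ge0 => //; exact: sqr_ge0.
  by rewrite K2/= addrAC lerDr addr_ge0.
- move=> iso; rewrite /Vn /In -intZ// -intB//; last exact: bmZ.
  have bb := bmB bV (bmZ (sigma ^+ 2) bI).
  have b0 : 0 <= C * r * sigma ^+ 2 by rewrite mulr_ge0 ?sqr_ge0// mulr_ge0// ltW.
  apply: le_trans (le_norm_int mO muoo bb) _.
  apply: (@le_trans _ _ (Rintegral mu Omega (fun=> k3 * (r * sigma ^+ 2)))).
    apply: int_le => //; [exact: bm_norm|exact: bm_cst|].
    move=> x Ox; apply: le_trans (trace_perturbation (L x) b0 iso) _.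
    apply: (@le_trans _ _ (C * r * sigma ^+ 2 * ((N * q * q)%:R * C ^+ 2))).
      by rewrite ler_wpM2l// tr_mul_trmx_le//; exact: L_le.
    by rewrite /k3 le_eqVlt; apply/orP; left; apply/eqP; ring.
  have rs0 : 0 <= r * sigma ^+ 2 by rewrite mulr_ge0 ?sqr_ge0// ltW.
  apply: le_trans (int_cst_le _ _) _; first by rewrite mulr_ge0.
  by apply: KE => //; rewrite K3/= lerDr addr_ge0.
- move=> a aE; rewrite [RHS]mulrAC [RHS]mulrC; congr (_ * _).
  have trE x : Omega x -> \tr ((L x)^T *m L x) = q%:R * enorm (a x) ^+ 2.
    by move=> Ox; rewrite edot_sqr; apply: opmx_tensor => v; exact: aE.
  have [q0|q0] := eqVneq (q%:R : R) 0.
    have -> : In = Rintegral mu Omega (fun=> 0).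
      by apply: int_eq => x Ox; rewrite trE// q0 mul0r.
    by rewrite int_cst// q0 !mul0r.
  rewrite -intZ//; first exact: int_eq.
  apply: eq_bm (bmZ q%:R^-1 bI) => x Ox.
  by rewrite trE// mulKf.
Qed.
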